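(* Let $(M,F,D)$ be a Berwald–Matveev manifold. For each point $p\in M$ let $b_p$ be the positive definite scalar product on $T_pM$ whose unit ball $\mathcal E(b_p)$ is the Loewner ellipsoid determined by the unit ball $B_p:=\{v\in T_pM\mid F(v)\le 1\}$. Then $$g_L:p\in M\longmapsto (g_L)_p:=b_p$$ is a (smooth) Riemannian metric on $M$, and the Levi-Civita derivative of $g_L$ is $D$.
   Context: $M$ is a finite-dimensional smooth manifold, Hausdorff, second countable and connected; $o$ is its zero vector field and $\mathring TM:=TM\setminus o(M)$. A gauge on a finite-dimensional real vector space $V$ is a function $f:V\to\mathbb R$ such that (i) $f$ is of class $C^2$ on $V\setminus\{0\}$; (ii) $f(\lambda v)=\lambda f(v)$ for all $v\in V$, $\lambda>0$; (iii) $f(v)>0$ for $v\ne0$; (iv) $f(v+w)\le f(v)+f(w)$ for all $v,w\in V$. A gauge function for $M$ is a function $F:TM\to\mathbb R$ that is of class $C^2$ on $\mathring TM$ and such that $F\upharpoonright T_pM$ is a gauge on $T_pM$ for each $p\in M$. A Berwald–Matveev manifold is a triplet $(M,F,D)$ where $F$ is a gauge function for $M$ and $D$ is a torsion-free covariant derivative (affine connection) on $M$ whose parallel translations preserve the $F$-norms of tangent vectors. An ellipsoid on a finite-dimensional real vector space $V$ is a set $\mathcal E(b):=\{v\in V\mid b(v,v)\le1\}$ with $b$ a positive definite scalar product on $V$. By the Loewner–Behrend theorem, if $V$ is endowed with a Lebesgue measure and $K\subset V$ is compact with non-empty interior, there is a unique least-volume ellipsoid containing $K$ (it does not depend on the choice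 of the Lebesgue measure); it is called the Loewner ellipsoid determined by $K$. *)

(* Defs.v *)
From HB Require Import structures.
From mathcomp Require Import all_boot all_order all_algebra.
From mathcomp Require Import all_classical all_reals all_analysis.

Set Implicit Arguments.
Unset Strict Implicit.
Unset Printing Implicit Defensive.

Import Order.TTheory GRing.Theory Num.Theory.
Import numFieldNormedType.Exports.

Local Open Scope classical_set_scope.
Local Open Scope ring_scope.

(* Meant for U open.  Differentiability and derivatives are those of f on the
   whole space, so at a point of an open U they only depend on f near it.  In
   finite dimension, "differentiable with all directional derivatives of class
   C^(k-1)" is the usual notion of class C^k. *)
Fixpoint Ck (R : realType) (V W : normedModType R) (k : nat) (U : set V)
    (f : V -> W) : Prop :=
  match k with
  | 0 => forall x, U x -> {for x, continuous f}
  | k'.+1 => (forall x, U x -> differentiable f x) /\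
             (forall v : V, Ck k' U (fun x => 'D_v f x))
  end.

Definition smooth_on (R : realType) (V W : normedModType R) (U : set V)
    (f : V -> W) : Prop := forall k, Ck k U f.

Record chart (R : realType) (n : nat) (T : topologicalType) := Chart {
  chart_dom : set T;
  chart_map : T -> 'rV[R]_n;
  chart_inv : 'rV[R]_n -> T }.

Definition chart_cod R n T (c : @chart R n T) : set 'rV[R]_n :=
  chart_map c @` chart_dom c.

Definition is_chart R n T (c : @chart R n T) : Prop :=
  [/\ open (chart_dom c),
      open (chart_cod c),
      (forall p, chart_dom c p -> chart_inv c (chart_map c p) = p),
      (forall p, chart_dom c p -> {for p, continuous (chart_map c)}) &
      (forall x, chart_cod c x -> {for x, continuous (chart_inv c)})].

(* The atlas need not be maximal: every notion below is invariant under
   enlarging it by compatible charts.  The field chart_at selects a chart around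
   each point; it is only used to represent T_pM by R^n. *)
Record smooth_manifold (R : realType) (n : nat) := SmoothManifold {
  carrier :> topologicalType;
  atlas : set (chart R n carrier);
  chart_at : carrier -> chart R n carrier;
  atlas_is_chart : forall c, atlas c -> is_chart c;
  atlas_compatible : forall c d, atlas c -> atlas d ->
    smooth_on (chart_map c @` (chart_dom c `&` chart_dom d))
              (chart_map d \o chart_inv c);
  chart_at_atlas : forall p, atlas (chart_at p);
  chart_at_dom : forall p, chart_dom (chart_at p) p;
  manifold_hausdorff : hausdorff_space carrier;
  manifold_second_countable : @second_countable carrier;
  manifold_connected : connected [set: carrier] }.

(* T_pM is represented by 'rV[R]_n: a tangent vector at p is the row of its
   coordinates in the chart chart_at p.  A function on TM is thus a function
   M -> 'rV[R]_n -> R. *)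
Section tangent_bundle.
Context {R : realType} {n : nat} (M : smooth_manifold R n).

Definition vector_field := M -> 'rV[R]_n.

(* coordinates in the chart c of the tangent vector v at p *)
Definition tangent_coord (c : chart R n M) (p : M) (v : 'rV[R]_n) : 'rV[R]_n :=
  'd (chart_map c \o chart_inv (chart_at p)) (chart_map (chart_at p) p) v.

(* the tangent vector at p whose coordinates in the chart c are y *)
Definition tangent_vec (c : chart R n M) (p : M) (y : 'rV[R]_n) : 'rV[R]_n :=
  'd (chart_map (chart_at p) \o chart_inv c) (chart_map c p) y.

Definition smooth_function (f : M -> R) : Prop :=
  forall c, atlas c -> smooth_on (chart_cod c) (f \o chart_inv c).

Definition smooth_field (X : vector_field) : Prop :=
  forall c, atlas c -> smooth_on (chart_cod c)
    (fun x => tangent_coord c (chart_inv c x) (X (chart_inv c x))).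

Definition field_deriv (X : vector_field) (f : M -> R) : M -> R := fun p =>
  'd (f \o chart_inv (chart_at p)) (chart_map (chart_at p) p) (X p).

End tangent_bundle.

Definition gauge (R : realType) (V : normedModType R) (f : V -> R) : Prop :=
  [/\ Ck 2 [set v | v != 0] f,
      (forall v (l : R), 0 < l -> f (l *: v) = l * f v),
      (forall v, v != 0 -> 0 < f v) &
      (forall v w, f (v + w) <= f v + f w)].

Definition gauge_function (R : realType) (n : nat) (M : smooth_manifold R n)
    (F : M -> 'rV[R]_n -> R) : Prop :=
  (forall c, atlas c ->
     Ck 2 [set z : 'rV[R]_n * 'rV[R]_n | chart_cod c z.1 /\ z.2 != 0]
       (fun z => F (chart_inv c z.1) (tangent_vec c (chart_inv c z.1) z.2))) /\
  (forall p, gauge (F p)).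

Section covariant_derivatives.
Context {R : realType} {n : nat} (M : smooth_manifold R n).
Implicit Types (D : vector_field M -> vector_field M -> vector_field M).
Implicit Types (X Y Z : vector_field M) (f : M -> R).

(* The values of D X Y are irrelevant unless X and Y are smooth. *)
Definition covariant_derivative D : Prop :=
  [/\ (forall X Y, smooth_field X -> smooth_field Y -> smooth_field (D X Y)),
      (forall X X' Y, smooth_field X -> smooth_field X' -> smooth_field Y ->
         D (X \+ X') Y = D X Y \+ D X' Y),
      (forall f X Y, smooth_function f -> smooth_field X -> smooth_field Y ->
         D (fun p => f p *: X p) Y = (fun p => f p *: D X Y p)),
      (forall X Y Y', smooth_field X -> smooth_field Y -> smooth_field Y' ->
         D X (Y \+ Y') = D X Y \+ D X Y') &
      (forall f X Y, smooth_function f -> smooth_field X -> smooth_field Y ->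
         D X (fun p => f p *: Y p) =
         (fun p => field_deriv X f p *: Y p + f p *: D X Y p))].

(* [X, Y] is determined by its action X Y - Y X on smooth functions. *)
Definition is_lie_bracket X Y Z : Prop :=
  forall f, smooth_function f -> forall p,
    field_deriv Z f p =
    field_deriv X (field_deriv Y f) p - field_deriv Y (field_deriv X f) p.

Definition torsion_free D : Prop :=
  forall X Y, smooth_field X -> smooth_field Y ->
    is_lie_bracket X Y (D X Y \- D Y X).

Definition smooth_curve (J : set R) (gamma : R -> M) : Prop :=
  (forall t, J t -> {for t, continuous gamma}) /\
  (forall c, atlas c ->
     smooth_on (J `&` gamma @^-1` chart_dom c) (chart_map c \o gamma)).

Definition velocity (gamma : R -> M) (t : R) : 'rV[R]_n :=
  (chart_map (chart_at (gamma t)) \o gamma)^`()%classic t.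

Definition smooth_field_along (J : set R) (gamma : R -> M)
    (V : R -> 'rV[R]_n) : Prop :=
  forall c, atlas c ->
    smooth_on (J `&` gamma @^-1` chart_dom c)
      (fun t => tangent_coord c (gamma t) (V t)).

(* W = (DV/dt)(t): if V = \sum_i f_i (X_i \o gamma) near t with smooth vector
   fields X_i on M, then
   (DV/dt)(t) = \sum_i (f_i'(t) X_i(gamma t) + f_i(t) D_{gamma'(t)} X_i).
   The vector D_{gamma'(t)} X_i is computed with any smooth field Y extending
   gamma'(t).  The result depends on none of these choices. *)
Definition covariant_derivative_along D (gamma : R -> M) (V : R -> 'rV[R]_n)
    (t : R) (W : 'rV[R]_n) : Prop :=
  exists (m : nat) (X : 'I_m -> vector_field M) (f : 'I_m -> R -> R)
         (Y : vector_field M),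
    [/\ (forall i, smooth_field (X i) /\ derivable (f i) t 1),
        smooth_field Y,
        Y (gamma t) = velocity gamma t,
        (\forall s \near t, V s = \sum_(i < m) f i s *: X i (gamma s)) &
        W = \sum_(i < m) ((f i)^`()%classic t *: X i (gamma t) +
                          f i t *: D Y (X i) (gamma t))].

(* Parallel translation along gamma, as the graph of the map
   T_(gamma s)M -> T_(gamma t)M sending v to w. *)
Definition parallel_translation D (gamma : R -> M) (s t : R)
    (v w : 'rV[R]_n) : Prop :=
  exists (a b : R) (V : R -> 'rV[R]_n),
    [/\ `]a, b[%classic s /\ `]a, b[%classic t,
        smooth_curve `]a, b[ gamma,
        smooth_field_along `]a, b[ gamma V,
        (forall r, `]a, b[%classic r ->
           covariant_derivative_along D gamma V r 0) &
        V s = v /\ V t = w].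

Definition parallel_translations_preserve D (F : M -> 'rV[R]_n -> R) : Prop :=
  forall gamma s t v w, parallel_translation D gamma s t v w ->
    F (gamma t) w = F (gamma s) v.

Definition berwald_matveev (F : M -> 'rV[R]_n -> R) D : Prop :=
  [/\ gauge_function F,
      covariant_derivative D,
      torsion_free D &
      parallel_translations_preserve D F].

End covariant_derivatives.

Definition scalar_product (R : realType) (V : lmodType R) (b : V -> V -> R) :=
  [/\ (forall v, scalar (b v)),
      (forall v w, b v w = b w v) &
      (forall v, v != 0 -> 0 < b v v)].

Section riemannian_metrics.
Context {R : realType} {n : nat} (M : smooth_manifold R n).
Implicit Types (g : M -> 'rV[R]_n -> 'rV[R]_n -> R).

Definition riemannian_metric g : Prop :=
  (forall p, scalar_product (g p)) /\
  (forall c, atlas c -> forall y z : 'rV[R]_n,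
     smooth_on (chart_cod c)
       (fun x => g (chart_inv c x) (tangent_vec c (chart_inv c x) y)
                                   (tangent_vec c (chart_inv c x) z))).

Definition metric_derivative g
    (D : vector_field M -> vector_field M -> vector_field M) : Prop :=
  forall X Y Z, smooth_field X -> smooth_field Y -> smooth_field Z ->
    forall p, field_deriv X (fun q => g q (Y q) (Z q)) p =
              g p (D X Y p) (Z p) + g p (Y p) (D X Z p).

Definition levi_civita g
    (D : vector_field M -> vector_field M -> vector_field M) : Prop :=
  [/\ covariant_derivative D, torsion_free D & metric_derivative g D].

End riemannian_metrics.

(* R^n as an iterated product of measurable spaces, so that n-dimensional
   Lebesgue measure is the n-fold product of the library's one. *)
Fixpoint Rn_display (R : realType) (n : nat) : measure_display :=
  match n with
  | 0 => default_measure_display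
  | n'.+1 => measure_prod_display
               ((R.-ocitv.-measurable).-sigma%mdisp, Rn_display R n')
  end.

Fixpoint Rn (R : realType) (n : nat) : measurableType (Rn_display R n) :=
  match n with
  | 0 => unit
  | n'.+1 => (measurableTypeR R * Rn R n')%type
  end.

Fixpoint Rn_lebesgue (R : realType) (n : nat) : set (Rn R n) -> \bar R :=
  match n return set (Rn R n) -> \bar R with
  | 0 => @dirac _ unit tt R
  | n'.+1 => (@lebesgue_measure R \x @Rn_lebesgue R n')%E
  end.

Fixpoint row_of_Rn (R : realType) (n : nat) : Rn R n -> 'rV[R]_n :=
  match n return Rn R n -> 'rV[R]_n with
  | 0 => fun=> 0
  | n'.+1 => fun x => row_mx (x.1 : R)%:M (row_of_Rn x.2)
  end.

(* Meant for Borel sets A.  On T_pM, written in the coordinates of chart_at p,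
   any other Lebesgue measure is a positive multiple of this one. *)
Definition volume (R : realType) (n : nat) (A : set 'rV[R]_n) : \bar R :=
  Rn_lebesgue (@row_of_Rn R n @^-1` A).

Definition ellipsoid (R : realType) (V : lmodType R) (b : V -> V -> R) : set V :=
  [set v | b v v <= 1].

Definition is_ellipsoid (R : realType) (V : lmodType R) (E : set V) : Prop :=
  exists2 b : V -> V -> R, scalar_product b & E = ellipsoid b.

(* By the Loewner-Behrend theorem, for K compact with non-empty interior exactly
   one E has this property. *)
Definition loewner_ellipsoid (R : realType) (n : nat) (K E : set 'rV[R]_n) :
    Prop :=
  [/\ is_ellipsoid E,
      K `<=` E &
      (forall E', is_ellipsoid E' -> K `<=` E' -> (volume E <= volume E')%E)].

Definition gauge_ball (R : realType) (V : Type) (f : V -> R) : set V :=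
  [set v | f v <= 1].

(* Main.v *)
(* Parallel translation from p to q along a curve is a linear bijection carrying
   the F-unit ball B_p onto B_q, hence (minimal volume being a linearly invariant
   notion) the Loewner ellipsoid of B_p onto that of B_q: the forms b_p are
   parallel.  The minimality is used through determinants: by completing squares
   and Fubini, the volume of an ellipsoid is a universal constant times
   det^(-1/2), so uniqueness of the minimal ellipsoid is the strict log-concavity
   of det on positive definite matrices.

   In a chart, transport along a coordinate line x + s v is governed by a linear
   ODE whose matrix is given by the Christoffel symbols, so the Gram matrix G of
   b satisfies
     d_v G = sum_k v_k (Gamma_k G + G Gamma_k^T)
   along every line.  This total differential system forces G to be bounded,
   then continuous, then smooth by bootstrapping, and it says that b is
   compatible with D in a coordinate frame; since the defect of compatibility is
   tensorial, b is compatible with D for all vector fields.  A torsion-free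
   metric derivative is the Levi-Civita derivative. *)
Require Import Defs.
From HB Require Import structures.
From mathcomp Require Import all_boot all_order all_algebra.
From mathcomp Require Import all_classical all_reals all_analysis.
From mathcomp Require Import measurable_realfun.
From mathcomp Require Import ring lra.

Set Implicit Arguments.
Unset Strict Implicit.
Unset Printing Implicit Defensive.

Import Order.TTheory GRing.Theory Num.Theory.
Import numFieldNormedType.Exports.

Local Open Scope classical_set_scope.
Local Open Scope ring_scope.

(** * Calculus of C^k maps *)

(** The forms b_p come from a minimum taken separately at each point, so nothing is known in advance
    about how they depend on p. The only link between different points is parallel translation, and
    its existence has to be supplied: the hypothesis on F and D only speaks of parallel fields that
    are already given. Solutions on short intervals suffice, because only derivatives at the
    starting point of a line are used. With W(s) the inverse of the transport matrix, G(x + s v) =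
    W(s) G(x) W(s)^T, and this differentiates G in every direction without any prior regularity.
    Directional derivatives alone do not give continuity, which is why a local bound has to come
    first.

    A second obstacle is that D accepts only global vector fields and locality is not among its
    axioms. Coordinate fields are therefore multiplied by a cutoff and extended by zero, and a
    squared cutoff lets linearity over smooth functions reduce arbitrary fields to this frame. *)

Section Ck_calculus.
Context {R : realType}.
Implicit Types V W : normedModType R.

Lemma Ck_sub V W k (U U' : set V) (f : V -> W) :
  U `<=` U' -> Ck k U' f -> Ck k U f.
Proof.
move=> UU'; elim: k f => [|k IHk] f /=; first by move=> H x /UU'/H.
by case=> df Df; split=> [x /UU'/df //|v]; apply: IHk.
Qed.

(** Derivatives are those of the ambient space, so [Ck] is a condition at each point separately,
    even when [U] is a single point. *)
Lemma Ck_pointwise V W k (U : set V) (f : V -> W) :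
  (forall x, U x -> Ck k [set x] f) -> Ck k U f.
Proof.
elim: k f => [|k IHk] f H /=; first by move=> x Ux; exact: (H x Ux x).
split=> [x Ux|v]; first by have [df _] := H x Ux; exact: df.
by apply: IHk => x Ux; have [_ Df] := H x Ux; exact: Df.
Qed.

Lemma is_diff_eps V W (f : V -> W) (L : {linear V -> W}) (x : V) :
  continuous L ->
  (forall e : R, 0 < e -> \forall h \near 0,
     `|f (h + x) - f x - L h| <= e * `|h|) ->
  is_diff x f L.
Proof.
move=> cL H.
have fo : f \o shift x = cst (f x) + L +o_ 0 id.
  apply/eqaddoP => e e0.
  near=> h; rewrite /= !fctE opprD addrA.
  by near: h; exact: H.
have dfL : 'd f x = L :> (V -> W) by exact: diff_unique.
apply: DiffDef => //.
by apply/diff_locallyP; rewrite dfL.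
Unshelve. all: by end_near. Qed.

Lemma diff_eps V W (f : V -> W) (x : V) : differentiable f x ->
  forall e : R, 0 < e -> \forall h \near 0,
     `|f (h + x) - f x - 'd f x h| <= e * `|h|.
Proof.
move=> /diff_locally /eqaddoP H e e0.
have := H e e0; apply: filterS => h /=.
by rewrite !fctE opprD addrA.
Qed.

Lemma near_eq_is_diff V W (f g : V -> W) x (df : V -> W) :
  (\near x, f x = g x) -> is_diff x f df -> is_diff x g df.
Proof.
move=> fg [dfx <-].
have fgx : f x = g x by exact: nbhs_singleton fg.
apply: is_diff_eps => [|e e0]; first exact: diff_continuous.
near=> h.
rewrite -fgx -(_ : f (h + x) = g (h + x)).
  by near: h; exact: diff_eps.
near: h; have := fg; rewrite (near_shift 0 x) /=.
by apply: filterS => h /=; rewrite subr0.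
Unshelve. all: by end_near. Qed.

Lemma near_eq_differentiable V W (f g : V -> W) x :
  (\near x, f x = g x) -> differentiable f x -> differentiable g x.
Proof. by move=> fg df; have [] := near_eq_is_diff fg (differentiableP df). Qed.

Lemma near_eq_diff V W (f g : V -> W) x :
  (\near x, f x = g x) -> differentiable f x -> 'd f x = 'd g x :> (V -> W).
Proof. by move=> fg df; have [_ ->] := near_eq_is_diff fg (differentiableP df). Qed.

Lemma Ck_ext V W k (U : set V) (f g : V -> W) :
  open U -> (forall x, U x -> f x = g x) -> Ck k U f -> Ck k U g.
Proof.
move=> oU; elim: k f g => [|k IHk] f g fg /=.
  move=> H x Ux; have nfg : \near x, f x = g x.
    by move: (open_nbhs_nbhs (conj oU Ux)); apply: filterS.
  rewrite /prop_for/= /continuous_at -(fg _ Ux).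
  by apply: cvg_trans (H x Ux); apply: near_eq_cvg.
have nfg x : U x -> \near x, f x = g x.
  by move=> Ux; move: (open_nbhs_nbhs (conj oU Ux)); apply: filterS.
move=> [df Df]; split=> [x Ux|v].
  by apply: near_eq_differentiable (df x Ux); exact: nfg.
by apply: IHk (Df v) => x Ux; exact/near_eq_derive/nfg.
Qed.

Lemma Ck_pred V W k (U : set V) (f : V -> W) : Ck k.+1 U f -> Ck k U f.
Proof.
elim: k f => [|k IHk] f [df Df].
  by move=> x /df; exact: differentiable_continuous.
by split=> [//|v]; exact: (IHk _ (Df v)).
Qed.

Lemma Ck_cst V W k (U : set V) (a : W) : Ck k U (fun _ : V => a).
Proof.
elim: k a => [|k IHk] a /=; first by move=> x _; exact: cst_continuous.
split=> [x _|v]; first exact: differentiable_cst.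
have -> : (fun x => 'D_v (fun _ : V => a) x) = fun _ => 0.
  by apply/funext => x; rewrite derive_cst.
exact: IHk.
Qed.

Lemma Ck_linear V W k (U : set V) (f : {linear V -> W}) :
  continuous f -> Ck k U f.
Proof.
move=> cf; case: k => [|k] /=; first by move=> x _; exact: cf.
split=> [x _|v]; first exact: linear_differentiable.
have -> : (fun x => 'D_v f x) = fun _ => f v.
  apply/funext => x; rewrite deriveE; last exact: linear_differentiable.
  by rewrite diff_lin.
exact: Ck_cst.
Qed.

Lemma Ck_id V k (U : set V) : Ck k U (fun x : V => x).
Proof. by apply: (@Ck_linear _ _ _ _ idfun) => x; exact: cvg_id. Qed.

Lemma Ck_add V W k (U : set V) (f g : V -> W) :
  open U -> Ck k U f -> Ck k U g -> Ck k U (fun x => f x + g x).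
Proof.
move=> oU; elim: k f g => [|k IHk] f g /=.
  by move=> cf cg x Ux; apply: (@continuousD _ _ _ f g); [exact: cf|exact: cg].
move=> [df Df] [dg Dg]; split=> [x Ux|v].
  by apply: (@differentiableD _ _ _ f g); [exact: df|exact: dg].
apply: Ck_ext (IHk _ _ (Df v) (Dg v)) => // x Ux.
by rewrite -deriveD //; apply: diff_derivable; [exact: df|exact: dg].
Qed.

Lemma Ck_mul V k (U : set V) (f g : V -> R) :
  open U -> Ck k U f -> Ck k U g -> Ck k U (fun x => f x * g x).
Proof.
move=> oU; elim: k f g => [|k IHk] f g.
  by move=> cf cg x Ux; apply: (@continuousM _ _ f g); [exact: cf|exact: cg].
move=> Cf Cg; have [[df Df] [dg Dg]] := (Cf, Cg); split=> [x Ux|v].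
  by apply: (@differentiableM _ _ f g); [exact: df|exact: dg].
have := Ck_add oU (IHk _ _ (Ck_pred Cf) (Dg v)) (IHk _ _ (Ck_pred Cg) (Df v)).
apply: Ck_ext => // x Ux.
by rewrite (@deriveM _ _ f g) //; apply: diff_derivable; [exact: df|exact: dg].
Qed.

Lemma Ck_sum V W k (U : set V) m (f : 'I_m -> V -> W) :
  open U -> (forall i, Ck k U (f i)) -> Ck k U (fun x => \sum_i f i x).
Proof.
move=> oU; elim: m f => [|m IHm] f H.
  have -> : (fun x => \sum_i f i x) = fun _ => 0.
    by apply/funext => x; rewrite big_ord0.
  exact: Ck_cst.
have -> : (fun x => \sum_i f i x) =
    fun x => f ord0 x + \sum_i f (lift ord0 i) x.
  by apply/funext => x; rewrite big_ord_recl.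
by apply: Ck_add => //; apply: IHm.
Qed.

Lemma Ck_opp V k (U : set V) (f : V -> R) :
  open U -> Ck k U f -> Ck k U (fun x => - f x).
Proof.
move=> oU Cf; have := Ck_mul oU (Ck_cst k U (-1 : R)) Cf.
by apply: Ck_ext => // x _; rewrite mulN1r.
Qed.


Lemma Ck_scale V W k (U : set V) (f : V -> R) (w : W) :
  open U -> Ck k U f -> Ck k U (fun x => f x *: w).
Proof.
move=> oU; elim: k f => [|k IHk] f.
  by move=> cf x Ux; apply: (@continuousZr_tmp _ _ _ f); exact: cf.
move=> [df Df]; split=> [x Ux|v].
  by apply: differentiableZl; exact: df.
apply: Ck_ext (IHk _ (Df v)) => // x Ux.
have dfx := df x Ux; have dz := differentiableZl w dfx.
by rewrite (deriveE _ dfx) (deriveE _ dz) diffZl.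
Qed.

Lemma Ck_row V m k (U : set V) (f : V -> 'rV[R]_m) :
  open U -> (forall j, Ck k U (fun x => f x 0 j)) -> Ck k U f.
Proof.
move=> oU H.
have -> : f = fun x => \sum_j f x 0 j *: (delta_mx 0 j : 'rV[R]_m).
  by apply/funext => x; exact: row_sum_delta.
by apply: Ck_sum => // j; exact: Ck_scale.
Qed.

Lemma derive_coord V m (f : V -> 'rV[R]_m) x v j : derivable f x v ->
  'D_v (fun x => f x 0 j) x = ('D_v f x) 0 j.
Proof. by move=> df; rewrite (derive_mx df) mxE. Qed.

Lemma differentiable_entry V m (f : V -> 'rV[R]_m) x j :
  differentiable f x -> differentiable (fun x => f x 0 j) x.
Proof.
move=> df.
apply: (@differentiable_comp _ _ _ _ f (fun y : 'rV[R]_m => y 0 j)) => //.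
exact: differentiable_coord.
Qed.

Lemma Ck_coord V m k (U : set V) (f : V -> 'rV[R]_m) j :
  open U -> Ck k U f -> Ck k U (fun x => f x 0 j).
Proof.
move=> oU; elim: k f => [|k IHk] f.
  move=> cf x Ux.
  apply: (@continuous_comp _ _ _ f (fun y : 'rV[R]_m => y 0 j)).
    exact: cf.
  exact: coord_continuous.
move=> [df Df]; split=> [x Ux|v].
  by apply: differentiable_entry; exact: df.
apply: Ck_ext (IHk _ (Df v)) => // x Ux.
by rewrite derive_coord //; apply: diff_derivable; exact: df.
Qed.

Lemma differentiable_linear_comp V V' W (l : {linear V' -> W}) (h : V -> V') x :
  continuous l -> differentiable h x -> differentiable (fun x => l (h x)) x.
Proof.
move=> cl dh; apply: (@differentiable_comp _ _ _ _ h l) => //.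
exact/linear_differentiable/cl.
Qed.

Lemma derive_linear_comp V V' W (l : {linear V' -> W}) (h : V -> V') x v :
  continuous l -> differentiable h x ->
  'D_v (fun x => l (h x)) x = l ('D_v h x).
Proof.
move=> cl dh; rewrite (deriveE _ dh) deriveE; last exact: differentiable_linear_comp.
rewrite (@diff_comp _ _ _ _ h l) //=; last exact/linear_differentiable/cl.
by rewrite (diff_lin _ cl).
Qed.

Lemma Ck_linear_comp V V' W k (U : set V) (l : {linear V' -> W}) (h : V -> V') :
  continuous l -> open U -> Ck k U h -> Ck k U (fun x => l (h x)).
Proof.
move=> cl oU; elim: k h => [|k IHk] h.
  by move=> ch x Ux; apply: (@continuous_comp _ _ _ h l); [exact: ch | exact: cl].
move=> [dh Dh]; split=> [x Ux|w].
  by apply: differentiable_linear_comp => //; exact: dh.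
apply: Ck_ext (IHk _ (Dh w)) => // x Ux.
by rewrite derive_linear_comp //; exact: dh.
Qed.

(** [Ck] is stated through directional derivatives, so the induction needs the chain rule as a
    finite sum of products: D_v (f o g) is the sum over j of l_j(D_v g) times (D_(e_j) f) o g. An
    abstract basis [e] with coordinate forms [l] covers both row vectors and R itself. *)
Lemma Ck_comp_basis V V' m (e : 'I_m -> V') (l : 'I_m -> {linear V' -> R})
    k (U : set V) (U' : set V') (g : V -> V') (f : V' -> R) :
  (forall j, continuous (l j)) -> (forall y, y = \sum_j l j y *: e j) ->
  open U -> open U' -> (forall x, U x -> U' (g x)) ->
  Ck k U' f -> Ck k U g -> Ck k U (fun x => f (g x)).
Proof.
move=> cl le oU oU' gU; elim: k g f gU => [|k IHk] g f gU Cf Cg.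
  move=> x Ux; apply: (@continuous_comp _ _ _ g f); first exact: Cg.
  by apply: Cf; exact: gU.
have dg x : U x -> differentiable g x by move=> Ux; case: Cg => + _; apply.
have df y : U' y -> differentiable f y by move=> Ux; case: Cf => + _; apply.
split=> [x Ux|v].
  by apply: (@differentiable_comp _ _ _ _ g f); [exact: dg|exact/df/gU].
have Dg j : Ck k U (fun x => l j ('D_v g x)).
  by apply: Ck_linear_comp => //; case: Cg => _; apply.
have Df j : Ck k U (fun x => 'D_(e j) f (g x)).
  apply: (IHk _ (fun y => 'D_(e j) f y)) => //; last exact: Ck_pred.
  by case: Cf => _; apply.
have := Ck_sum oU (fun j => Ck_mul oU (Dg j) (Df j)).
apply: Ck_ext => // x Ux.
have dfx := df _ (gU _ Ux).
rewrite (@deriveE _ _ _ (f \o g)); last first.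
  by apply: differentiable_comp => //; exact: dg.
rewrite diff_comp //=; last exact: dg.
rewrite -(deriveE _ (dg _ Ux)) [in RHS](le ('D_v g x)) linear_sum.
apply: eq_bigr => j _; rewrite linearZ /= (deriveE _ dfx).
reflexivity.
Qed.

Lemma Ck_comp V m k (U : set V) (U' : set 'rV[R]_m) (g : V -> 'rV[R]_m)
    (f : 'rV[R]_m -> R) :
  open U -> open U' -> (forall x, U x -> U' (g x)) ->
  Ck k U' f -> Ck k U g -> Ck k U (fun x => f (g x)).
Proof.
move=> oU oU' gU; pose l j := (fun y : 'rV[R]_m => y 0 j).
have ll j : linear (l j) by move=> a x y; rewrite /l !mxE.
pose lm j := GRing.isLinear.Build _ _ _ _ (l j) (ll j).
pose L j : {linear 'rV[R]_m -> R} := HB.pack (l j) (lm j).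
apply: (@Ck_comp_basis _ _ _ (fun j => delta_mx 0 j) L) => //.
  by move=> j; exact: coord_continuous.
by move=> y; exact: row_sum_delta.
Qed.

Lemma Ck_comp1 V k (U : set V) (U' : set R) (g : V -> R) (f : R -> R) :
  open U -> open U' -> (forall x, U x -> U' (g x)) ->
  Ck k U' f -> Ck k U g -> Ck k U (fun x => f (g x)).
Proof.
move=> oU oU' gU.
apply: (@Ck_comp_basis _ _ 1 (fun=> 1 : R) (fun=> idfun)) => //.
  by move=> j x; exact: cvg_id.
by move=> y; rewrite big_ord1 /= -[LHS]mulr1.
Qed.

Lemma Ck_comp_row V m m' k (U : set V) (U' : set 'rV[R]_m) (g : V -> 'rV[R]_m)
    (f : 'rV[R]_m -> 'rV[R]_m') :
  open U -> open U' -> (forall x, U x -> U' (g x)) ->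
  Ck k U' f -> Ck k U g -> Ck k U (fun x => f (g x)).
Proof.
move=> oU oU' gU Cf Cg; apply: Ck_row => // j.
by apply: (Ck_comp (f := fun y => f y 0 j) oU oU' gU) => //; exact: Ck_coord.
Qed.

End Ck_calculus.

(** * Smooth cutoffs *)

Section bump.
Context {R : realType}.

Lemma Ck_derive1 k (U : set R) (f f' : R -> R) :
  open U -> (forall t, U t -> is_derive t (1 : R) f (f' t)) ->
  Ck k U f' -> Ck k.+1 U f.
Proof.
move=> oU df Cf'.
have dff t : U t -> differentiable f t.
  by move=> Ut; apply/derivable1_diffP; have [] := df t Ut.
split=> // v.
apply: (@Ck_ext _ _ _ _ U (fun t => v * f' t)) => //; last first.
  by apply: Ck_mul => //; exact: Ck_cst.
move=> t Ut; have [_ <-] := df t Ut.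
rewrite !(deriveE _ (dff _ Ut)).
by rewrite -[X in _ = 'd f t X]mulr1 -[v * 1]/(v *: (1 : R)) linearZ.
Qed.

(* A family closed under differentiation, up to linear combinations. *)
Definition eflat m (t : R) : R :=
  if 0 < t then t^-1 ^+ m * expR (- t^-1) else 0.

(** The inequality x <= e^x at x = s/m, raised to the power m; the case m = 0 is separate. *)
Lemma exprn_expRN_le m (s : R) : 0 <= s -> s ^+ m * expR (- s) <= m%:R ^+ m.
Proof.
case: m => [|m] s0; first by rewrite !expr0 mul1r -expR0 ler_expR oppr_le0.
have m0 : 0 < m.+1%:R :> R by rewrite ltr0n.
set k : R := m.+1%:R in m0 *.
rewrite expRN ler_pdivrMr ?expR_gt0 //.
have -> : expR s = expR (s / k) ^+ m.+1.
  by rewrite -expRM_natl -/k mulrC divfK // lt0r_neq0.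
rewrite -exprMn lerXn2r ?nnegrE ?mulr_ge0 ?expR_ge0 ?(ltW m0) //.
rewrite -ler_pdivrMl // mulrC.
by apply: le_trans (expR_ge1Dx _); rewrite lerDr.
Qed.

(** The preceding bound with exponent m + 2 at 1/t leaves a factor t^2. This quadratic decay yields
    the vanishing derivative at 0. *)
Lemma eflat_le m (t : R) : `|eflat m t| <= m.+2%:R ^+ m.+2 * t ^+ 2.
Proof.
rewrite /eflat; case: ifPn => t0; last first.
  by rewrite normr0 mulr_ge0 ?sqr_ge0 // exprn_ge0.
have s0 : 0 <= t^-1 by rewrite invr_ge0 ltW.
rewrite ger0_norm ?mulr_ge0 ?exprn_ge0 ?expR_ge0 //.
rewrite -ler_pdivrMr ?exprn_gt0 //.
apply: le_trans (exprn_expRN_le m.+2 s0).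
by rewrite -exprVn mulrAC -exprD addn2.
Qed.

Lemma is_derive_eflat m (t : R) :
  is_derive t (1 : R) (eflat m) (eflat m.+2 t - m%:R * eflat m.+1 t).
Proof.
have [t0|t0|<-] := ltgtP 0 t.
- have tn0 := lt0r_neq0 t0.
  have near_eq : \near t, t^-1 ^+ m * expR (- t^-1) = eflat m t.
    near=> s; rewrite /eflat ifT //; near: s; exact: lt_nbhsr.
  apply: near_eq_is_derive near_eq _.
  have dV : is_derive t (1 : R) (fun s : R => s^-1) (- t ^- 2).
    by apply: is_derive_eq; [exact: is_deriveV | rewrite /GRing.scale /= mulr1].
  have dE : is_derive t (1 : R) (fun s : R => expR (- s^-1))
      (expR (- t^-1) * t ^- 2).
    have dN : is_derive t (1 : R) (fun s : R => - s^-1) (t ^- 2).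
      by rewrite -[t ^- 2]opprK; exact: (is_deriveN dV).
    exact: (@is_derive1_comp _ expR (fun s : R => - s^-1) _ _ _ _ dN).
  have dX : is_derive t (1 : R) (fun s : R => s^-1 ^+ m)
      (m%:R * t^-1 ^+ m.-1 * (- t ^- 2)).
    have := is_deriveX m dV.
    by rewrite exprfctE.
  have [dM vM] := is_deriveM dX dE; apply: DeriveDef => //; rewrite vM.
  rewrite /eflat t0 /GRing.scale /=.
  case: m {dX dM vM} => [|m] /=; rewrite ?mul0r ?mulr0 ?subr0 ?addr0.
    by rewrite expr0 mul1r mulrC exprVn.
  by rewrite -exprVn !exprS; ring.
- have near_eq : \near t, 0 = eflat m t.
    near=> s; rewrite /eflat ifF //; apply/negbTE; rewrite -leNgt ltW //.
    near: s; exact: lt_nbhsl.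
  apply: near_eq_is_derive near_eq _.
  rewrite /eflat !ifF ?mulr0 ?subr0; last 2 first.
  - by apply/negbTE; rewrite -leNgt ltW.
  - by apply/negbTE; rewrite -leNgt ltW.
  exact: is_derive_cst.
- have e0 k : eflat k 0 = 0 by rewrite /eflat ltxx.
  rewrite !e0 mulr0 subr0.
  have [df dE] : is_diff (0 : R) (eflat m) (\0 : {linear R -> R}).
    apply: is_diff_eps => [|e e_gt0]; first by move=> x; exact: cst_continuous.
    pose C : R := m.+2%:R ^+ m.+2.
    have C0 : 0 < C by rewrite exprn_gt0 // ltr0n.
    near=> h; rewrite addr0 e0 subr0 /= subr0.
    apply: le_trans (eflat_le m h) _.
    rewrite -/C -real_normK ?num_real // expr2 mulrA ler_wpM2r //.
    rewrite mulrC -ler_pdivlMr // ltW //.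
    near: h; exact: (@nbhs0_lt _ R _ (divr_gt0 e_gt0 C0)).
  apply: DeriveDef; first exact: diff_derivable.
  by rewrite deriveE // dE.
Unshelve. all: by end_near. Qed.

Lemma Ck_eflat k m (U : set R) : Ck k U (eflat m).
Proof.
apply: (@Ck_sub _ _ _ _ U setT) => //.
elim: k m => [|k IHk] m.
  move=> x _; apply: differentiable_continuous; apply/derivable1_diffP.
  by have [] := is_derive_eflat m x.
apply: Ck_derive1; [exact: openT|by move=> t _; exact: is_derive_eflat|].
apply: Ck_add; [exact: openT|exact: IHk|].
apply: Ck_opp; first exact: openT.
apply: Ck_mul; [exact: openT|exact: Ck_cst|exact: IHk].
Qed.

Lemma eflat0_gt0 (t : R) : 0 < t -> 0 < eflat 0 t.
Proof. by move=> t0; rewrite /eflat t0 expr0 mul1r expR_gt0. Qed.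

Lemma eflat0_le (s t : R) : s <= t -> eflat 0 s <= eflat 0 t.
Proof.
move=> st; rewrite /eflat !expr0 !mul1r; case: ifPn => s0; last first.
  by case: ifPn => // _; rewrite expR_ge0.
have t0 : 0 < t by exact: lt_le_trans st.
by rewrite t0 ler_expR lerN2 lef_pV2.
Qed.

Lemma eflat0_npos (t : R) : t <= 0 -> eflat 0 t = 0.
Proof. by move=> t0; rewrite /eflat ifF //; apply/negbTE; rewrite -leNgt. Qed.

(** The inner difference is the positive constant [eflat 0 1] for t <= 1 and is nonpositive for t >=
    2, where the outer [eflat 0] flattens it to 0. Nesting makes the denominator a constant. *)
Definition plateau (t : R) : R :=
  eflat 0 (eflat 0 1 - eflat 0 (t - 1)) / eflat 0 (eflat 0 1).

Lemma plateau_eq1 t : t <= 1 -> plateau t = 1.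
Proof.
move=> t1; rewrite /plateau (@eflat0_npos (t - 1)) ?subr_le0 // subr0 divff //.
by rewrite lt0r_neq0 // !eflat0_gt0.
Qed.

Lemma plateau_eq0 t : 2 <= t -> plateau t = 0.
Proof.
move=> t2; rewrite /plateau (@eflat0_npos (_ - _)) ?mul0r // subr_le0.
by apply: eflat0_le; rewrite lerBrDr.
Qed.

Lemma Ck_plateau k (U : set R) : Ck k U plateau.
Proof.
apply: (@Ck_sub _ _ _ _ U setT) => //.
rewrite /plateau; apply: Ck_mul; [exact: openT| |exact: Ck_cst].
apply: (@Ck_comp1 _ _ _ _ setT) => //; [exact: openT|exact: openT|exact: Ck_eflat|].
apply: Ck_add; [exact: openT|exact: Ck_cst|].
apply: Ck_opp; first exact: openT.
apply: (@Ck_comp1 _ _ _ _ setT) => //; [exact: openT|exact: openT|exact: Ck_eflat|].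
by apply: Ck_add; [exact: openT|exact: Ck_id|exact: Ck_cst].
Qed.

Lemma smooth_cutoff n (x0 : 'rV[R]_n) (U : set 'rV[R]_n) :
  nbhs x0 U -> exists beta : 'rV[R]_n -> R, exists K : set 'rV[R]_n,
    [/\ (forall k V, Ck k V beta), \forall x \near x0, beta x = 1,
        compact K, K `<=` U & forall x, ~ K x -> beta x = 0].
Proof.
move=> /nbhs_ballP [r /= r0 rU].
(* The squared Euclidean distance is smooth, unlike the sup norm that defines the balls. *)
pose q (x : 'rV[R]_n) : R := \sum_j ((x 0 j - x0 0 j) * (x 0 j - x0 0 j)).
have Cq k : Ck k setT q.
  have Cx j : Ck k setT (fun x : 'rV[R]_n => x 0 j - x0 0 j).
    apply: Ck_add; [exact: openT| |exact: Ck_cst].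
    by apply: Ck_coord; [exact: openT|exact: Ck_id].
  by apply: Ck_sum => [|j]; [exact: openT|apply: Ck_mul => //; exact: openT].
have qge (x : 'rV[R]_n) j : (x 0 j - x0 0 j) ^+ 2 <= q x.
  rewrite /q (bigD1 j) //= -expr2 lerDl sumr_ge0 // => i _.
  by rewrite -expr2 sqr_ge0.
have q0 : q x0 = 0 by rewrite /q big1 // => j _; rewrite subrr mul0r.
(* Outside the box [K] of half-width r/2, q >= r^2/4 makes the argument of [plateau] at least 2;
   where q < r^2/8 this argument is below 1. *)
pose beta x := plateau (q x * (8 / r ^+ 2)).
pose K := [set x : 'rV[R]_n | forall j, `[x0 0 j - r / 2, x0 0 j + r / 2]%classic (x 0 j)].
exists beta, K; split.
- move=> k V; apply: (@Ck_sub _ _ _ _ V setT) => //.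
  rewrite /beta; apply: (@Ck_comp1 _ _ _ _ setT _ plateau) => //; [exact: openT|exact: openT|exact: Ck_plateau|].
  by apply: Ck_mul; [exact: openT|exact: Cq|exact: Ck_cst].
- have cq : q x @[x --> x0] --> q x0 by exact: (Cq 0%N x0 I).
  have c0 : 0 < r ^+ 2 / 8 by rewrite divr_gt0 ?exprn_gt0.
  near=> x; apply: plateau_eq1.
  rewrite -ler_pdivlMr ?divr_gt0 ?exprn_gt0 // div1r invf_div ltW //.
  near: x; apply: (cvgr_lt _ cq); by rewrite q0.
- exact: (@rV_compact _ _ (fun j => `[x0 0 j - r / 2, x0 0 j + r / 2]%classic)
    (fun j => @segment_compact _ _ _)).
- move=> x Kx; apply: rU; rewrite -ball_normE /ball_ /=.
  rewrite [ltLHS]/Num.Def.normr /= mx_normrE.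
  apply: (@le_lt_trans _ _ (r / 2)); last by rewrite ltr_pdivrMr // ltr_pMr ?ltr1n.
  apply: bigmax_le => [|[i j] _ /=]; first by rewrite ltW // divr_gt0.
  rewrite ord1 !mxE; have := Kx j; rewrite /= in_itv /= => /andP[h1 h2].
  by rewrite ler_norml; apply/andP; split; lra.
- move=> x nK; apply: plateau_eq0.
  have [j hj] : exists j, r / 2 < `|x 0 j - x0 0 j|.
    apply: contrapT => /forallNP H; apply: nK => j.
    have /negP := H j; rewrite -leNgt ler_norml => /andP[h1 h2].
    by rewrite /= in_itv /=; apply/andP; split; lra.
  rewrite -ler_pdivrMr ?divr_gt0 ?exprn_gt0 //.
  apply: le_trans (qge x j).
  rewrite -[(x 0 j - x0 0 j) ^+ 2]real_normK ?num_real // invf_div.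
  apply: (@le_trans _ _ ((r / 2) ^+ 2)).
    by rewrite expr_div_n; lra.
  by rewrite lerXn2r ?nnegrE ?(ltW hj) // ltW // divr_gt0.
Unshelve. all: by end_near. Qed.

End bump.

(** * Volumes of ellipsoids *)

Section quadratic_forms.
Context {R : realType}.

Definition qform n (A : 'M[R]_n) (y : 'rV[R]_n) : R := (y *m A *m y^T) 0 0.

Definition posdef n (A : 'M[R]_n) : Prop :=
  A^T = A /\ forall y, y != 0 -> 0 < qform A y.

Lemma mx11_tr (x : 'M[R]_1) : x^T = x.
Proof. by apply/matrixP => i j; rewrite mxE !ord1. Qed.

Lemma bform_sym n (A : 'M[R]_n) (y z : 'rV[R]_n) : A^T = A ->
  y *m A *m z^T = z *m A *m y^T.
Proof. by move=> sA; rewrite -[LHS]mx11_tr !trmx_mul trmxK sA mulmxA. Qed.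

Lemma qformE n (A : 'M[R]_n) y : y *m A *m y^T = (qform A y)%:M.
Proof. exact: mx11_scalar. Qed.

Lemma qform0 n (A : 'M[R]_n) : qform A 0 = 0.
Proof. by rewrite /qform mul0mx mul0mx mxE. Qed.

Lemma qform_ge0 n (A : 'M[R]_n) y : posdef A -> 0 <= qform A y.
Proof.
move=> [_ pA]; have [->|/pA/ltW //] := eqVneq y 0; by rewrite qform0.
Qed.

Lemma posdef_unit n (A : 'M[R]_n) : posdef A -> A \in unitmx.
Proof.
move=> [_ pA]; rewrite unitmxE unitfE; apply/det0P => -[v v0 vA].
by have := pA v v0; rewrite /qform vA mul0mx mxE ltxx.
Qed.

Definition schur_row n (A : 'M[R]_(1 + n)) : 'rV[R]_n :=
  ursubmx A *m invmx (drsubmx A).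

(** For symmetric A with invertible lower block A22, the subtracted term is A12 A22^(-1) A21, so
    this is the usual Schur complement of A22. *)
Definition schur_compl n (A : 'M[R]_(1 + n)) : R :=
  ulsubmx A 0 0 - qform (drsubmx A) (schur_row A).

Lemma posdef_dr n (A : 'M[R]_(1 + n)) : posdef A -> posdef (drsubmx A).
Proof.
move=> [sA pA]; split=> [|y y0]; first by rewrite trmx_drsub sA.
have := pA (row_mx 0 y); rewrite /qform -[A]submxK tr_row_mx mul_row_block.
rewrite mul_row_col !mul0mx !add0r trmx0 mulmx0 add0r submxK; apply.
by rewrite -row_mx0; apply: contraNneq y0 => /eq_row_mx [_ ->].
Qed.

(** Elimination of the first coordinate by a unipotent congruence. It gives both the completed
    square and the factorization of the determinant, and it shows that A is determined by its Schur
    complement, its Schur row and its lower block. *)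
Lemma schur_block n (A : 'M[R]_(1 + n)) : posdef A ->
  A = block_mx 1%:M (schur_row A) 0 1%:M
      *m block_mx (schur_compl A)%:M 0 0 (drsubmx A)
      *m (block_mx 1%:M (schur_row A) 0 1%:M)^T.
Proof.
move=> pA; have uB := posdef_unit (posdef_dr pA); have [sA _] := pA.
have sB : (drsubmx A)^T = drsubmx A by rewrite trmx_drsub sA.
have uBE : schur_row A *m drsubmx A = ursubmx A by rewrite mulmxKV.
rewrite tr_block_mx !trmx1 trmx0 !mulmx_block.
rewrite !(mul1mx, mulmx1, mul0mx, mulmx0, addr0, add0r) uBE.
rewrite [LHS](esym (submxK A)); congr block_mx.
  rewrite /schur_compl [ulsubmx A]mx11_scalar [ursubmx A *m _](_ : _ = (qform (drsubmx A) (schur_row A))%:M).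
    by rewrite -raddfD /= subrK !mxE.
  by rewrite -qformE uBE.
by rewrite -[drsubmx A in RHS]sB -trmx_mul uBE trmx_ursub sA.
Qed.

Lemma qform_schur n (A : 'M[R]_(1 + n)) s z : posdef A ->
  qform A (row_mx s%:M z) =
  schur_compl A * s ^+ 2 + qform (drsubmx A) (z + s *: schur_row A).
Proof.
move=> pA; rewrite {1}(schur_block pA) /qform.
set P := block_mx 1%:M _ _ _; set v := row_mx _ _.
have vP : v *m P = row_mx s%:M (z + s *: schur_row A).
  by rewrite mul_row_block !mulmx1 mulmx0 addr0 mul_scalar_mx addrC.
rewrite !mulmxA -[_ *m P^T *m v^T]mulmxA -trmx_mul vP mul_row_block.
rewrite !mulmx0 addr0 add0r tr_row_mx mul_row_col mxE; congr (_ + _).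
by rewrite tr_scalar_mx -!scalar_mxM !mxE eqxx mulr1n; ring.
Qed.

Lemma schur_compl_gt0 n (A : 'M[R]_(1 + n)) : posdef A -> 0 < schur_compl A.
Proof.
move=> pA; have := qform_schur 1 (- schur_row A) pA.
rewrite scale1r addNr qform0 expr1n mulr1 addr0 => <-; case: pA => _; apply.
rewrite -row_mx0; apply/eqP => /eq_row_mx [/matrixP/(_ 0 0)].
by rewrite !mxE eqxx => /eqP; rewrite oner_eq0.
Qed.

Lemma det_schur n (A : 'M[R]_(1 + n)) : posdef A ->
  \det A = schur_compl A * \det (drsubmx A).
Proof.
move=> pA; rewrite {1}(schur_block pA) !det_mulmx det_tr.
by rewrite !det_ublock !det1 !mul1r mulr1 det_scalar1.
Qed.

Lemma posdef_det_gt0 n (A : 'M[R]_n) : posdef A -> 0 < \det A.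
Proof.
elim: n A => [|n IHn] A pA; first by rewrite det_mx00.
by rewrite (det_schur pA) mulr_gt0 ?schur_compl_gt0 // IHn //; exact: posdef_dr.
Qed.

End quadratic_forms.

Section volume_of_ellipsoids.
Context {R : realType}.

Local Notation mu := (@lebesgue_measure R).

Lemma measurable_affine (s w : R) :
  measurable_fun setT ((fun x => s * (x - w)) : measurableTypeR R -> measurableTypeR R).
Proof.
apply: (@continuous_measurable_fun R (fun x => s * (x - w))) => x.
by apply: cvgM; [exact: cvg_cst|apply: cvgB; [exact: cvg_id|exact: cvg_cst]].
Qed.

(** The image of Lebesgue measure under x -> s (x - w), multiplied by s, gives each half-open
    interval its length, hence is Lebesgue measure by uniqueness. *)
Lemma ge0_integral_affine (s w : R) (f : R -> R) : 0 < s ->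
  measurable_fun setT f -> (forall x, 0 <= f x) ->
  (\int[mu]_x (f (s * (x - w)))%:E = (s^-1)%:E * \int[mu]_x (f x)%:E)%E.
Proof.
move=> s0 mf f0.
pose g := (fun x => s * (x - w)) : measurableTypeR R -> measurableTypeR R.
have mg : measurable_fun setT g by exact: measurable_affine.
pose nu : {measure set (measurableTypeR R) -> \bar R} :=
  measure_function_pushforward__canonical__measure_function_Measure mu mg.
have muE : forall A, measurable A ->
    mu A = mscale (NngNum (ltW s0)) nu A.
  apply: lebesgue_measure_unique => _ [[a b]] _ <- /=.
  rewrite /mscale /= /nu /= /pushforward /=.
  rewrite (_ : g @^-1` _ = `]w + a / s, w + b / s]%classic); last first.
    apply/seteqP; split=> x /=; rewrite /g !in_itv /=.
      by rewrite mulrC -ltr_pdivrMr // -ler_pdivlMr // ltrBrDl lerBlDl.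
    by rewrite -ltrBrDl -lerBlDl ltr_pdivrMr // ler_pdivlMr // mulrC.
  rewrite !lebesgue_measure_itv /= !lte_fin ltrD2l ltr_pM2r ?invr_gt0 //.
  case: ifPn => ab; last by rewrite mule0.
  rewrite !EFinN -!EFinD -EFinM; congr EFin.
  by field; rewrite lt0r_neq0.
have -> : (\int[mu]_x (f x)%:E = s%:E * \int[mu]_x (f (s * (x - w)))%:E)%E.
  rewrite (eq_measure_integral (mscale (NngNum (ltW s0)) nu)); last first.
    by move=> A mA _; exact: muE.
  rewrite ge0_integral_mscale //=; first last.
  - by move=> x _; rewrite lee_fin.
  - exact/measurable_EFinP.
  rewrite ge0_integral_pushforward //=.
  - exact/measurable_EFinP.
  - by move=> x _; rewrite lee_fin.
by rewrite muleA -EFinM mulVf ?lt0r_neq0 // mul1e.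
Qed.


(** Centre and level are parameters because a slice of a centred ellipsoid is an ellipsoid with
    another centre and another level; the induction on the dimension needs this closure. *)
Definition Rn_ellipsoid n (A : 'M[R]_n) (w : 'rV[R]_n) (r : R) : set (Rn R n) :=
  @row_of_Rn R n @^-1` [set y | qform A (y - w) <= r].

(* By completing the square. *)
Lemma xsection_Rn_ellipsoid n (A : 'M[R]_(1 + n)) (w : 'rV[R]_(1 + n)) r x :
  posdef A ->
  xsection (@Rn_ellipsoid n.+1 A w r) x =
  @Rn_ellipsoid n (drsubmx A)
    (rsubmx w - (x - lsubmx w 0 0) *: schur_row A)
    (r - schur_compl A * (x - lsubmx w 0 0) ^+ 2).
Proof.
move=> pA.
have E (y : R) (z : 'rV[R]_n) : row_mx y%:M z - w =
    row_mx (y - lsubmx w 0 0)%:M (z - rsubmx w).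
  rewrite -{1}[w]hsubmxK [lsubmx w]mx11_scalar opp_row_mx add_row_mx -raddfB /=.
  by rewrite [in RHS]mxE eqxx mulr1n.
have H z : (qform A (row_mx (x : R)%:M (row_of_Rn z) - w) <= r) =
  (qform (drsubmx A) (row_of_Rn z - (rsubmx w - (x - lsubmx w 0 0) *: schur_row A))
    <= r - schur_compl A * (x - lsubmx w 0 0) ^+ 2).
  by rewrite E qform_schur // lerBrDl opprB addrA addrAC.
by apply/seteqP; split=> z; rewrite /xsection /= inE /Rn_ellipsoid /= H.
Qed.

(** The integrand is at most v(r) and vanishes once x^2 > r, which bounds the integral; it is at
    least v(r/2) where |x| <= sqrt(r/2), which makes the integral positive. *)
Lemma integral_vol_profile (v : R -> R) (r : R) :
  (forall s t, s <= t -> v s <= v t) -> (forall t, t < 0 -> v t = 0) ->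
  (forall t, 0 <= v t) ->
  (\int[mu]_x (v (r - x ^+ 2))%:E < +oo)%E /\
  ((forall t, 0 < t -> 0 < v t) -> 0 < r ->
    (0 < \int[mu]_x (v (r - x ^+ 2))%:E)%E).
Proof.
move=> v_nd v_neg v_ge0.
have mV : measurable_fun setT (fun x : R => v (r - x ^+ 2)).
  apply: (@measurableT_comp _ _ _ _ _ _ v); last first.
    by apply: measurable_funB => //; exact: measurable_funX.
  by apply: nondecreasing_measurable => // s t; exact: v_nd.
have cst_int (a k : R) : 0 <= a -> 0 <= k ->
    (\int[mu]_x ((k * \1_(`[- a, a]%classic) x)%:E) = (k * (2 * a))%:E)%E.
  move=> a0 k0; under eq_integral do rewrite EFinM.
  rewrite ge0_integralZl //=; last first.
    by apply/measurable_EFinP; exact: measurable_indic.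
  rewrite integral_indic // setIT.
  rewrite [X in (_ * X)%E](lebesgue_measure_itv `[- a, a]) /= lte_fin.
  case: ifPn => [_|]; first by rewrite -EFinD -EFinM; congr EFin; ring.
  rewrite -leNgt => h; have -> : a = 0 by lra.
  by rewrite mule0 !mulr0.
have mk (a k : R) : measurable_fun setT (EFin \o (fun x => k * \1_(`[- a, a]%classic) x)).
  by apply/measurable_EFinP; apply: measurable_funM => //; exact: measurable_indic.
split.
  (* For r < 0 the interval [-a, a] degenerates to the point 0. *)
  pose a := Num.sqrt (Num.max 0 r).
  have a0 : 0 <= a by exact: sqrtr_ge0.
  apply: (@le_lt_trans _ _ (v r * (2 * a))%:E); last by rewrite ltry.
  rewrite -cst_int //; apply: ge0_le_integral => //.
  + by move=> x _; rewrite lee_fin.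
  + exact/measurable_EFinP.
  + exact: mk.
  move=> x _; rewrite lee_fin indicE; case: (boolP (_ \in _)) => [_|].
    by rewrite mulr1; apply: v_nd; rewrite gerBl sqr_ge0.
  rewrite notin_setE /= in_itv /= -ler_norml => /negP; rewrite -ltNge => ax.
  rewrite mulr0 v_neg // subr_lt0 -real_normK ?num_real //.
  apply: (@le_lt_trans _ _ (a ^+ 2)); last by rewrite ltrXn2r // nnegrE.
  by rewrite sqr_sqrtr ?le_max ?lexx ?orbT.
move=> v_gt0 r0.
pose a := Num.sqrt (r / 2).
have a0 : 0 < a by rewrite sqrtr_gt0 divr_gt0.
apply: (@lt_le_trans _ _ (v (r / 2) * (2 * a))%:E).
  by rewrite lte_fin !mulr_gt0 // v_gt0 // divr_gt0.
rewrite -cst_int ?(ltW a0) //; apply: ge0_le_integral => //.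
+ by move=> x _; rewrite lee_fin mulr_ge0.
+ exact: mk.
+ exact/measurable_EFinP.
move=> x _; rewrite lee_fin indicE; case: (boolP (_ \in _)) => [|_]; last first.
  by rewrite mulr0.
rewrite inE /= in_itv /= -ler_norml mulr1 => xa; apply: v_nd.
rewrite lerBrDr -lerBrDl [leRHS](_ : _ = r / 2); last by field.
rewrite -real_normK ?num_real // -[leRHS]sqr_sqrtr ?divr_ge0 ?(ltW r0) //.
by rewrite lerXn2r // nnegrE // ltW.
Qed.

(** The profile is the volume of the Euclidean ball of squared radius r, obtained recursively as the
    integral of v(r - x^2) and never computed. The volume of a slice does not depend on its centre,
    so only the level r - c (x - w_1)^2 matters, with c the Schur complement; the substitution y =
    sqrt(c) (x - w_1) produces the factor c^(-1/2) that completes det^(-1/2). Monotonicity serves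
    measurability and the bounds, positivity the comparison of determinants. *)
Lemma volume_profile n : exists v : R -> R,
  [/\ (forall s t, s <= t -> v s <= v t), (forall t, t < 0 -> v t = 0),
      (forall t, 0 <= v t), (forall t, 0 < t -> 0 < v t) &
      forall (A : 'M[R]_n) w r, posdef A ->
        Rn_lebesgue (Rn_ellipsoid A w r) = (v r / Num.sqrt (\det A))%:E].
Proof.
elim: n => [|n [v [v_nd v_neg v_ge0 v_gt0 vE]]].
  (* In dimension 0 the ball is a point when r >= 0 and empty otherwise. *)
  exists (fun r : R => (0 <= r)%R%:R); split.
  - move=> s t st; rewrite ler_nat; case: (leP 0 s) => // s0.
    by rewrite (le_trans s0).
  - by move=> t t0; rewrite leNgt t0.
  - by move=> t; rewrite ler0n.
  - by move=> t /ltW ->; rewrite ltr01.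
  - move=> A w r pA; rewrite det_mx00 sqrtr1 divr1 /= diracE.
    congr (_%:R%:E); congr nat_of_bool.
    have q0 (y : 'rV[R]_0) : qform A y = 0 by rewrite [y]thinmx0 qform0.
    by apply/idP/idP; rewrite inE /Rn_ellipsoid /= q0.
pose V r := (\int[mu]_x (v (r - x ^+ 2))%:E)%E.
have mV r : measurable_fun setT (fun x : R => v (r - x ^+ 2)).
  apply: (@measurableT_comp _ _ _ _ _ _ v); last first.
    by apply: measurable_funB => //; exact: measurable_funX.
  by apply: nondecreasing_measurable => // s t; exact: v_nd.
have Vfin r : V r \is a fin_num.
  rewrite ge0_fin_numE; last by apply: integral_ge0 => x _; rewrite lee_fin.
  by have [] := integral_vol_profile r v_nd v_neg v_ge0.
have VE r : V r = (fine (V r))%:E by rewrite fineK.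
exists (fun r => fine (V r)); split.
- move=> s t st; rewrite -lee_fin !fineK //.
  apply: ge0_le_integral => //.
  + by move=> x _; rewrite lee_fin.
  + exact: (measurableT_comp (@EFin_measurable _ setT) (mV _)).
  + exact: (measurableT_comp (@EFin_measurable _ setT) (mV _)).
  + by move=> x _; rewrite lee_fin; apply: v_nd; rewrite lerB.
- move=> t t0; rewrite /V (eq_integral (cst 0%E)) ?integral0 // => x _.
  by rewrite v_neg // subr_lt0 (lt_le_trans t0) // sqr_ge0.
- by move=> t; apply: fine_ge0; apply: integral_ge0 => x _; rewrite lee_fin.
- move=> t t0; rewrite -lte_fin fineK //.
  by have [_] := integral_vol_profile t v_nd v_neg v_ge0; apply.
- move=> A0 w0 r; pose A : 'M[R]_(1 + n) := A0; pose w : 'rV[R]_(1 + n) := w0.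
  rewrite -[A0]/A -[w0]/w => pA.
  have c0 := schur_compl_gt0 pA; set c := schur_compl A in c0.
  have pB := posdef_dr pA.
  rewrite /= /product_measure1.
  transitivity (\int[mu]_x ((Num.sqrt (\det (drsubmx A)))^-1 *
     v (r - (Num.sqrt c * (x - lsubmx w 0 0)) ^+ 2))%:E)%E.
    apply: eq_integral => x _ /=.
    rewrite (xsection_Rn_ellipsoid _ _ _ pA) (vE _ _ _ pB) mulrC.
    by rewrite exprMn sqr_sqrtr // ltW.
  under eq_integral do rewrite EFinM.
  rewrite ge0_integralZl //=; last 2 first.
  + apply: (measurableT_comp (@EFin_measurable _ setT)).
    apply: (measurableT_comp (mV r)).
    exact: (measurable_affine (Num.sqrt c) (lsubmx w 0 0)).
  + by move=> x _; rewrite lee_fin.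
  rewrite (ge0_integral_affine _ (f := fun y => v (r - y ^+ 2))) ?sqrtr_gt0 //.
  rewrite -/(V r) VE -!EFinM; congr EFin.
  rewrite (det_schur pA) -/c sqrtrM ?(ltW c0) // invfM.
  by rewrite mulrA mulrC; congr (_ * _); rewrite mulrC.
Qed.

End volume_of_ellipsoids.

(** * Loewner ellipsoids *)

Section loewner.
Context {R : realType}.

Lemma qformD n (A B : 'M[R]_n) y : qform (A + B) y = qform A y + qform B y.
Proof. by rewrite /qform mulmxDr mulmxDl mxE. Qed.

Lemma qformZ n a (A : 'M[R]_n) y : qform (a *: A) y = a * qform A y.
Proof. by rewrite /qform -scalemxAr -scalemxAl mxE. Qed.

Lemma posdef_mid n (A B : 'M[R]_n) :
  posdef A -> posdef B -> posdef (2^-1 *: (A + B)).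
Proof.
move=> [sA pA] [sB pB]; split=> [|y y0].
  by rewrite linearZ linearD /= sA sB.
by rewrite qformZ qformD mulr_gt0 // addr_gt0 ?pA ?pB.
Qed.

Lemma posdef_congr n (A T : 'M[R]_n) :
  T \in unitmx -> posdef A -> posdef (T *m A *m T^T).
Proof.
move=> uT [sA pA]; split=> [|y y0].
  by rewrite !trmx_mul trmxK sA mulmxA.
rewrite /qform !mulmxA -mulmxA -trmx_mul; apply: pA.
by apply: contra y0 => /eqP yT; rewrite -[y](mulmxK uT) yT mul0mx.
Qed.

Lemma qform_congr n (A T : 'M[R]_n) y :
  qform (T *m A *m T^T) y = qform A (y *m T).
Proof. by rewrite /qform trmx_mul !mulmxA. Qed.

(* Strict log-concavity of the determinant, by induction on the size: a Schur
   complement is the minimum of a quadratic form over an affine hyperplane,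
   hence is concave in the form. *)
Lemma det_mid n (A B : 'M[R]_n) : posdef A -> posdef B ->
  \det A * \det B <= \det (2^-1 *: (A + B)) ^+ 2 /\
  (\det (2^-1 *: (A + B)) ^+ 2 <= \det A * \det B -> A = B).
Proof.
elim: n A B => [|n IHn] A0 B0.
  by move=> _ _; rewrite !det_mx00 expr1n mulr1; split=> // _; rewrite [A0]flatmx0 [B0]flatmx0.
pose A : 'M[R]_(1 + n) := A0; pose B : 'M[R]_(1 + n) := B0.
rewrite -[A0]/A -[B0]/B => pA pB.
set M : 'M[R]_(1 + n) := _ *: _; have pM : posdef M by exact: posdef_mid.
have dM : drsubmx M = 2^-1 *: (drsubmx A + drsubmx B).
  by apply/matrixP => i j; rewrite !mxE.
have [le_det eq_det] := IHn _ _ (posdef_dr pA) (posdef_dr pB).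
rewrite -dM in le_det eq_det.
rewrite (det_schur pA) (det_schur pB) (det_schur pM).
have a0 := schur_compl_gt0 pA; have b0 := schur_compl_gt0 pB.
have m0 := schur_compl_gt0 pM.
set u := schur_row M.
(* The vector with first coordinate 1 completed by -u minimizes the form M on that hyperplane. There
   M takes its Schur complement as value, while A and B take theirs plus the nonnegative excesses s
   and t. *)
have mE : schur_compl M = 2^-1 * (schur_compl A + schur_compl B) +
    2^-1 * (qform (drsubmx A) (schur_row A - u) +
            qform (drsubmx B) (schur_row B - u)).
  have := qform_schur 1 (- u) pM.
  rewrite scale1r addNr qform0 addr0 expr1n mulr1 => <-.
  rewrite qformZ qformD !qform_schur // !scale1r !expr1n !mulr1.
  by rewrite ![- u + _]addrC; ring.
have qA := qform_ge0 (schur_row A - u) (posdef_dr pA).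
have qB := qform_ge0 (schur_row B - u) (posdef_dr pB).
have dA := posdef_det_gt0 (posdef_dr pA); have dB := posdef_det_gt0 (posdef_dr pB).
have d0 := mulr_gt0 dA dB.
set a := schur_compl A in a0 mE *; set b := schur_compl B in b0 mE *.
set m := schur_compl M in m0 mE *.
set x := \det (drsubmx A) in le_det eq_det dA d0 *.
set y := \det (drsubmx B) in le_det eq_det dB d0 *.
set z := \det (drsubmx M) in le_det eq_det *.
set s := qform _ (schur_row A - u) in qA mE.
set t := qform _ (schur_row B - u) in qB mE.
have -> : a * x * (b * y) = a * b * (x * y) by ring.
rewrite exprMn.
have ab0 : 0 < a * b by exact: mulr_gt0.
have ab_ge0 : 0 <= 2^-1 * (a + b) by lra.
have mab : a * b <= m ^+ 2.
  apply: (@le_trans _ _ ((2^-1 * (a + b)) ^+ 2)).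
    have : 0 <= (a - b) ^+ 2 by exact: sqr_ge0.
    by rewrite !expr2; nra.
  rewrite lerXn2r ?nnegrE ?(ltW m0) ?ab_ge0 //.
  by rewrite mE; lra.
split.
  by apply: ler_pM => //; rewrite ltW.
move=> le_ab.
have mm0 : 0 < m ^+ 2 by rewrite exprn_gt0.
(* Since m^2 >= ab and z^2 >= xy hold already, the reverse inequality between the products reverses
   each of them. *)
have zle : z ^+ 2 <= x * y.
  rewrite -(ler_pM2l mm0); apply: le_trans le_ab _.
  by rewrite ler_pM2r.
have mle : m ^+ 2 <= a * b.
  rewrite -(ler_pM2r d0); apply: le_trans le_ab.
  by rewrite ler_pM2l.
have AB' := eq_det zle.
have ab : a = b.
  apply/eqP; rewrite -subr_eq0 -sqrf_eq0 eq_le sqr_ge0 andbT.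
  have : (2^-1 * (a + b)) ^+ 2 <= m ^+ 2.
    rewrite lerXn2r ?nnegrE ?(ltW m0) ?ab_ge0 //.
    by rewrite mE; lra.
  by move: mle; rewrite !expr2; nra.
have ma : m <= a.
  by rewrite -ler_sqr ?nnegrE ?(ltW m0) ?(ltW a0) // [leRHS]expr2 {2}ab.
(* As m <= a = b, no room is left for the excesses; both Schur rows then equal u, and all block data
   of A and B agree. *)
have s0 : s = 0 by apply/eqP; rewrite eq_le qA andbT; lra.
have t0 : t = 0 by apply/eqP; rewrite eq_le qB andbT; lra.
have uA : schur_row A = u.
  apply/eqP; rewrite -subr_eq0; apply: contraT => /((posdef_dr pA).2 _).
  by rewrite -/s s0 ltxx.
have uB : schur_row B = u.
  apply/eqP; rewrite -subr_eq0; apply: contraT => /((posdef_dr pB).2 _).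
  by rewrite -/t t0 ltxx.
by rewrite (schur_block pA) (schur_block pB) -/a -/b uA uB AB' ab.
Qed.

Definition gram n (b : 'rV[R]_n -> 'rV[R]_n -> R) : 'M[R]_n :=
  \matrix_(i, j) b (delta_mx 0 i) (delta_mx 0 j).

Lemma scalar_sum n m (f : 'rV[R]_n -> R) (c : 'I_m -> R) (e : 'I_m -> 'rV[R]_n) :
  scalar f -> f (\sum_i c i *: e i) = \sum_i c i * f (e i).
Proof.
move=> sf.
have f0 : f 0 = 0.
  by have := sf (-1) 0 0; rewrite scaler0 addr0 mulN1r addNr.
elim/big_rec2 : _ => // i y1 y2 _ <-.
by rewrite sf.
Qed.

Lemma gramE n (b : 'rV[R]_n -> 'rV[R]_n -> R) y z : scalar_product b ->
  b y z = (y *m gram b *m z^T) 0 0.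
Proof.
move=> [lb sb _].
rewrite {1}(row_sum_delta z) (scalar_sum _ _ (lb y)) mxE.
apply: eq_bigr => j _; rewrite !mxE mulrC; congr (_ * _).
rewrite sb {1}(row_sum_delta y) (scalar_sum _ _ (lb _)) .
by apply: eq_bigr => i _; rewrite !mxE sb.
Qed.

Lemma posdef_gram n (b : 'rV[R]_n -> 'rV[R]_n -> R) :
  scalar_product b -> posdef (gram b).
Proof.
move=> spb; have [_ sb pb] := spb; split=> [|y y0].
  by apply/matrixP => i j; rewrite !mxE sb.
by rewrite /qform -gramE // pb.
Qed.

Lemma scalar_product_posdef n (A : 'M[R]_n) : posdef A ->
  scalar_product (fun y z : 'rV[R]_n => (y *m A *m z^T) 0 0).
Proof.
move=> [sA pA]; split=> [v a y z|v w|v v0].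
- by rewrite linearP /= mulmxDr -scalemxAr !mxE.
- by rewrite bform_sym.
- exact: pA.
Qed.

Lemma volume_ellipsoid_le n (b c : 'rV[R]_n -> 'rV[R]_n -> R) :
  scalar_product b -> scalar_product c ->
  (volume (ellipsoid b) <= volume (ellipsoid c))%E ->
  \det (gram c) <= \det (gram b).
Proof.
move=> spb spc.
have [v [_ _ _ v_gt0 vE]] := @volume_profile R n.
have volE (d : 'rV[R]_n -> 'rV[R]_n -> R) : scalar_product d ->
    volume (ellipsoid d) = (v 1 / Num.sqrt (\det (gram d)))%:E.
  move=> spd; rewrite -(vE _ 0 1 (posdef_gram spd)) /volume; congr Rn_lebesgue.
  by apply/seteqP; split=> x; rewrite /Rn_ellipsoid /ellipsoid /= subr0 /qform -gramE.
rewrite !volE // lee_fin ler_pM2l ?v_gt0 //.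
have db := posdef_det_gt0 (posdef_gram spb).
have dc := posdef_det_gt0 (posdef_gram spc).
rewrite lef_pV2 ?posrE ?sqrtr_gt0 //.
by move=> h; rewrite -ler_sqrt // ltW.
Qed.

(** Turns minimal volume into a maximal determinant among the positive definite matrices with form
    at most 1 on [K]. These constraints are stable under midpoints, which is what the uniqueness
    argument exploits. *)
Lemma loewner_det_max n (K : set 'rV[R]_n) (b : 'rV[R]_n -> 'rV[R]_n -> R) :
  scalar_product b -> loewner_ellipsoid K (ellipsoid b) ->
  (forall y, K y -> qform (gram b) y <= 1) /\
  forall C, posdef C -> (forall y, K y -> qform C y <= 1) ->
    \det C <= \det (gram b).
Proof.
move=> spb [_ Kb minb]; split=> [y /Kb|C pC KC].
  by rewrite /ellipsoid /= /qform -gramE.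
have spC := scalar_product_posdef pC.
have := minb _ (ex_intro2 _ _ _ spC erefl) KC.
move=> /(volume_ellipsoid_le spb spC); congr (\det _ <= _).
apply/matrixP => i j; rewrite mxE -rowE trmx_delta -colE !mxE //.
Qed.

(* If both ellipsoids were distinct after transport, their midpoint form would
   give an ellipsoid of smaller volume. *)
Lemma loewner_equivariant n (K K' : set 'rV[R]_n)
    (b b' : 'rV[R]_n -> 'rV[R]_n -> R) (T : 'M[R]_n) :
  T \in unitmx -> (forall y, K' (y *m T) <-> K y) ->
  scalar_product b -> scalar_product b' ->
  loewner_ellipsoid K (ellipsoid b) -> loewner_ellipsoid K' (ellipsoid b') ->
  forall y z, b' (y *m T) (z *m T) = b y z.
Proof.
move=> uT KT spb spb' lK lK'.
have [KA maxA] := loewner_det_max spb lK.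
have [KA' maxA'] := loewner_det_max spb' lK'.
have pA := posdef_gram spb; have pA' := posdef_gram spb'.
suff AE : gram b = T *m gram b' *m T^T.
  by move=> y z; rewrite !gramE // AE trmx_mul !mulmxA.
(* B is the form [b'] pulled back by T; its midpoint with A is still at most 1 on [K]. *)
set B := T *m _ *m _; have pB : posdef B by exact: posdef_congr.
set A := gram b in KA maxA pA *.
have pC := posdef_mid pA pB.
set C := _ *: _ in pC.
have KC y : K y -> qform C y <= 1.
  move=> Ky; have h1 := KA _ Ky; have h2 := KA' _ ((KT y).2 Ky).
  by rewrite qformZ qformD qform_congr; lra.
have CA : \det C <= \det A by exact: maxA.
have uTi : invmx T \in unitmx by rewrite unitmx_inv.
(* Pushed forward by T, C becomes a competitor for [K']. The resulting comparison of determinants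
   pulls back, both sides being multiplied by det(T)^2. *)
have CB : \det C <= \det B.
  have : \det (invmx T *m C *m (invmx T)^T) <= \det (gram b').
    apply: maxA'; first exact: posdef_congr.
    move=> y Ky; rewrite qform_congr; apply: KC.
    by apply/KT; rewrite mulmxKV.
  rewrite !det_mulmx !det_tr det_inv => h.
  have dT : \det T != 0 by rewrite -unitfE -unitmxE.
  have dT2 : 0 < \det T * \det T by rewrite -expr2 exprn_even_gt0.
  rewrite mulrAC -(ler_pdivrMl _ _ dT2) // invfM; apply: le_trans h.
  by rewrite mulrAC.
(* Maximality on both sides gives det(C)^2 <= det(A) det(B), the equality case of log-concavity. *)
have [_] := det_mid pA pB; apply.
by rewrite expr2; apply: ler_pM => //; apply/ltW/posdef_det_gt0.
Qed.

End loewner.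

(** * Linear ordinary differential equations *)

Section real_analysis.
Context {R : realType}.
Local Notation mu := (@lebesgue_measure R).

Lemma is_derive_continuous (f : R -> R) (t df : R) :
  is_derive t (1 : R) f df -> {for t, continuous f}.
Proof.
by case=> /derivable1_diffP dft _; exact: differentiable_continuous.
Qed.

Lemma mean_value_bound (f f' : R -> R) (a b M : R) :
  (forall t, a <= t <= b -> is_derive t (1 : R) f (f' t)) ->
  (forall t, a <= t <= b -> `|f' t| <= M) -> a <= b ->
  `|f b - f a| <= M * (b - a).
Proof.
move=> df bf ab.
have [c cab ->] : exists2 c, c \in `[a, b] & f b - f a = f' c * (b - a).
  apply: MVT_segment => // [x|].
    by rewrite in_itv /= => /andP[/ltW ax /ltW xb]; apply: df; rewrite ax xb.
  apply: continuous_in_subspaceT => x; rewrite inE /= in_itv /= => xab.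
  exact: is_derive_continuous (df _ xab).
rewrite normrM (ger0_norm (x := b - a)) ?subr_ge0 // ler_wpM2r ?subr_ge0 //.
by apply: bf; move: cab; rewrite in_itv.
Qed.

Lemma geometric_small (B e : R) : 0 < e -> exists k, B * 2^-1 ^+ k < e.
Proof.
move=> e0; have := @cvg_geometric R B 2^-1.
rewrite ger0_norm ?invr_ge0 // invf_lt1 ?ltr1n // => /(_ isT).
move=> /cvgr0Pnorm_lt /(_ e e0) [k _ /(_ k (leqnn k)) /= h].
by exists k; exact: le_lt_trans (ler_norm _) h.
Qed.

Lemma geometric_cauchy (u : nat -> R) (B : R) : 0 <= B ->
  (forall k, `|u k.+1 - u k| <= B * 2^-1 ^+ k) ->
  exists l, forall k, `|l - u k| <= 2 * B * 2^-1 ^+ k.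
Proof.
move=> B0 hu.
have hum k m : `|u (k + m)%N - u k| <= 2 * B * 2^-1 ^+ k - 2 * B * 2^-1 ^+ (k + m).
  elim: m => [|m IHm]; first by rewrite addn0 !subrr normr0.
  rewrite addnS -(subrKA (u (k + m)%N)) (le_trans (ler_normD _ _)) //.
  apply: le_trans (lerD (hu _) IHm) _.
  rewrite [2^-1 ^+ (k + m).+1]exprS; lra.
have hum' k m : (k <= m)%N -> `|u m - u k| <= 2 * B * 2^-1 ^+ k.
  move=> /subnKC <-; apply: le_trans (hum _ _) _.
  by rewrite gerBl mulr_ge0 ?exprn_ge0 ?mulr_ge0.
have cu : cvg (u @ \oo).
  apply/cauchy_cvgP/cauchyP => e e0.
  have [k hk] := geometric_small (2 * B) e0.
  exists (u k); exists k => // m /= km.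
  rewrite -ball_normE /= distrC; exact: le_lt_trans (hum' _ _ km) hk.
exists (lim (u @ \oo)) => k.
have cn : `|u m - u k| @[m --> \oo] --> `|lim (u @ \oo) - u k|.
  by apply: cvg_norm; apply: cvgB => //; exact: cvg_cst.
rewrite -(cvg_lim _ cn) //; apply: limr_le; first by apply/cvg_ex; eexists; exact: cn.
by exists k => // m /= km; exact: hum'.
Qed.

Lemma uniform_limit_geometric_continuous (u : nat -> R -> R) (l : R -> R) (B : R) :
  (forall k, continuous (u k)) ->
  (forall k s, `|l s - u k s| <= B * 2^-1 ^+ k) -> continuous l.
Proof.
move=> cu hl s; apply/cvgrPdist_le => e e0.
have e3 : 0 < e / 3 by rewrite divr_gt0.
have [k hk] := geometric_small B e3.
have hk' t : `|l t - u k t| <= e / 3.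
  exact: le_trans (hl k t) (ltW hk).
near=> t.
have h1 := hk' s; have h2 := hk' t; rewrite distrC in h2.
have h3 : `|u k s - u k t| <= e / 3.
  by near: t; have /cvgrPdist_le := cu k s; apply.
have -> : l s - l t = (l s - u k s) + ((u k s - u k t) + (u k t - l t)) by ring.
apply: le_trans (ler_normD _ _) _; apply: le_trans (lerD (lexx _) (ler_normD _ _)) _.
lra.
Unshelve. all: by end_near. Qed.

Lemma clamp_continuous (h : R) : continuous (fun s : R => Num.max (- h) (Num.min h s)).
Proof.
move=> s; apply: (@continuous_max _ _ (fun=> - h) (fun s => Num.min h s)).
  exact: cvg_cst.
apply: (@continuous_min _ _ (fun=> h) (fun s => s)); [exact: cvg_cst|exact: cvg_id].
Qed.

(* The primitives are extended by constants outside ]-h, h[, which makes the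
   Picard iterates global continuous functions with global estimates. *)
Lemma primitive_operator (h : R) : 0 < h -> exists P : (R -> R) -> R -> R,
  (forall f, continuous f -> [/\ continuous (P f), P f 0 = 0 &
     forall s, - h < s < h -> is_derive s (1 : R) (P f) (f s)]) /\
  (forall f g M, continuous f -> continuous g ->
     (forall s, `|f s - g s| <= M) -> forall s, `|P f s - P g s| <= h * M) /\
  (forall s, P (fun=> 0) s = 0).
Proof.
move=> h0.
(* The integral starts at -2h so that [-h, h] lies inside the open interval where the fundamental
   theorem gives two-sided derivatives. *)
pose G (f : R -> R) x := (\int[mu]_(t in `[- (2 * h), x]) f t)%R.
have dG f x : continuous f -> - (2 * h) < x < 2 * h ->
    is_derive x (1 : R) (G f) (f x).
  move=> cf /andP[h1 h2].
  have intf : mu.-integrable `[- (2 * h), 2 * h] (EFin \o f).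
    apply: continuous_compact_integrable; first exact: segment_compact.
    exact: continuous_subspaceT.
  have [dGx vG] := continuous_FTC1_closed h2 intf h1 (cf x).
  by apply: (DeriveDef dGx); rewrite -derive1E; exact: vG.
pose clamp s := Num.max (- h) (Num.min h s).
have clampP s : - h <= clamp s <= h.
  by rewrite /clamp le_max lexx /= ge_max ge_min lexx andbT; lra.
have clampE s : - h <= s <= h -> clamp s = s.
  move=> /andP[h1 h2]; rewrite /clamp (min_idPr _) ?(max_idPr _) //.
exists (fun f s => G f (clamp s) - G f 0); split=> [f cf|].
  split.
  - move=> s; apply: cvgB; last exact: cvg_cst.
    apply: (@continuous_comp _ _ _ clamp (G f)); first exact: clamp_continuous.
    apply: is_derive_continuous; apply: dG => //.
    by have := clampP s; lra.
  - by rewrite clampE ?subrr //; lra.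
  - move=> s sh.
    apply: (@near_eq_is_derive _ _ _ (fun s => G f s - G f 0)).
      near=> t; rewrite clampE //; apply/andP; split; apply/ltW; near: t.
        by apply: lt_nbhsr; lra.
      by apply: lt_nbhsl; lra.
    have s2 : - (2 * h) < s < 2 * h by lra.
    have := is_deriveB (dG f s cf s2) (is_derive_cst (G f 0) s (1 : R)).
    by rewrite subr0.
split=> [f g M cf cg fgM s|s]; last first.
  by rewrite /G /Rintegral !integral0 subrr.
have -> : G f (clamp s) - G f 0 - (G g (clamp s) - G g 0) =
  (G f (clamp s) - G g (clamp s)) - (G f 0 - G g 0) by ring.
have dD t : - h <= t <= h ->
    is_derive t (1 : R) (fun t => G f t - G g t) (f t - g t).
  by move=> th; apply: is_deriveB; apply: dG => //; lra.
have M0 : 0 <= M by apply: le_trans (fgM 0).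
have /andP[c1 c2] := clampP s.
case: (leP 0 (clamp s)) => c0.
  apply: le_trans (@mean_value_bound (fun t => G f t - G g t) (fun t => f t - g t)
    0 (clamp s) M _ _ _) _ => //.
    by move=> t /andP[t1 t2]; apply: dD; lra.
  by rewrite subr0 mulrC ler_wpM2r.
rewrite distrC.
apply: le_trans (@mean_value_bound (fun t => G f t - G g t) (fun t => f t - g t)
    (clamp s) 0 M _ _ _) _ => //.
  by move=> t /andP[t1 t2]; apply: dD; lra.
  exact: ltW.
by rewrite sub0r mulrC ler_wpM2r //; lra.
Unshelve. all: by end_near. Qed.


Lemma cvg_mulmx_entry n (T : Type) (F : set_system T) (FF : Filter F)
    (f g : T -> 'M[R]_n) (a b : 'M[R]_n) :
  (forall i j, f x i j @[x --> F] --> a i j) ->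
  (forall i j, g x i j @[x --> F] --> b i j) ->
  forall i j, (f x *m g x) i j @[x --> F] --> (a *m b) i j.
Proof.
move=> fa gb i j; rewrite mxE; under eq_fun do rewrite mxE.
apply: cvg_big => // [|l _]; last exact: cvgM.
exact: add_continuous.
Qed.

(** Picard iteration on an interval so short that each step halves the distance. The coefficient
    acts on the right because vectors are rows. *)
Lemma linear_ode n (A : R -> 'M[R]_n) (r : R) : 0 < r ->
  (forall i j, smooth_on `]- r, r[%classic (fun s => A s i j)) ->
  exists h : R, exists U : R -> 'M[R]_n,
    [/\ 0 < h <= r, U 0 = 1%:M,
        (forall i j, smooth_on `]- h, h[%classic (fun s => U s i j)) &
        forall s, - h < s < h -> forall i j,
          is_derive s (1 : R) (fun s => U s i j) ((U s *m A s) i j)].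
Proof.
move=> r0 sA.
have cA s i j : - r < s < r -> {for s, continuous (fun s => A s i j)}.
  by move=> sr; apply: (sA i j 0%N); rewrite /= in_itv.
(* The extra 1 leaves room for the entries of A to stay below C near 0. *)
pose C : R := 1 + \sum_i \sum_j `|A 0 i j|.
have C1 : 1 <= C by rewrite lerDl; apply: sumr_ge0 => i _; apply: sumr_ge0.
have C0 : 0 < C by exact: lt_le_trans C1.
have AC i j : `|A 0 i j| + 1 <= C.
  rewrite /C addrC lerD2l (bigD1 i) //= (bigD1 j) //= -addrA lerDl.
  by rewrite addr_ge0 // sumr_ge0 // => k _; apply: sumr_ge0.
have near_bd : \forall s \near (0 : R), forall ij : 'I_n * 'I_n, `|A s ij.1 ij.2| <= C.
  suff H (ij : 'I_n * 'I_n) : \forall s \near (0 : R), `|A s ij.1 ij.2| <= C.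
    exact: (@filter_forall _ _ _ (nbhs (0 : R)) _ H).
  case: ij => i j /=.
  have r00 : - r < 0 < r by lra.
  have A0C : `|A 0 i j| < C by apply: lt_le_trans (AC i j); rewrite ltrDl.
  have H2 : \forall s \near (0 : R), `|A s i j| < C.
    exact: (cvgr_norm_lt _ (cA 0 i j r00) C A0C).
  by apply: filterS H2 => s /ltW.
have [h0 /= h00 hbd] : exists2 h0 : R, 0 < h0 &
    forall s i j, `|s| < h0 -> `|A s i j| <= C.
  move: near_bd => /nbhs_ballP [d /= d0 db]; exists d => // s i j sd.
  by apply: (db s _ (i, j)); rewrite -ball_normE /= sub0r normrN.
have nC0 : 0 < 2 * n.+1%:R * C by rewrite !mulr_gt0 // ltr0n.
(* The first two bounds keep [-h, h] inside the interval of smoothness and inside the one where the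
   entries of A are at most C; the third gives the contraction factor 1/2. The successor of n keeps
   the constant positive in dimension 0. *)
pose h := Num.min (r / 2) (Num.min (h0 / 2) (2 * n.+1%:R * C)^-1).
have h_gt0 : 0 < h by rewrite !lt_min !divr_gt0 //= invr_gt0.
have hr : h < r by rewrite gt_min; apply/orP; left; lra.
have hh0 : h < h0 by rewrite !gt_min; apply/orP; right; apply/orP; left; lra.
have hC : h * (n.+1%:R * C) <= 2^-1.
  have : h <= (2 * n.+1%:R * C)^-1 by rewrite !ge_min lexx !orbT.
  by rewrite -[_^-1]mul1r ler_pdivlMr // => H; lra.
have [P [P1 [P2 P3]]] := primitive_operator h_gt0.
pose clamp s := Num.max (- h) (Num.min h s).
have clampP s : - h <= clamp s <= h.
  by rewrite /clamp le_max lexx /= ge_max ge_min lexx andbT; lra.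
have clampE s : - h < s < h -> clamp s = s.
  move=> /andP[/ltW h1 /ltW h2]; rewrite /clamp (min_idPr _) ?(max_idPr _) //.
(* Freezing A outside [-h, h] makes all estimates global in s and changes nothing on the
   interval. *)
pose Ac s := A (clamp s).
have cAc i j : continuous (fun s => Ac s i j).
  move=> s; apply: (@continuous_comp _ _ _ clamp (fun s => A s i j)).
    exact: clamp_continuous.
  by apply: cA; have := clampP s; lra.
have bAc s i j : `|Ac s i j| <= C.
  by apply: hbd; rewrite ltr_norml; have := clampP s; lra.
have cmul (V : R -> 'M[R]_n) : (forall i j, continuous (fun s => V s i j)) ->
    forall i j, continuous (fun s => (V s *m Ac s) i j).
  by move=> cV i j s; apply: cvg_mulmx_entry => k l; [exact: cV|exact: cAc].
have bmul (V : 'M[R]_n) s B : (forall i j, `|V i j| <= B) ->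
    forall i j, h * `|(V *m Ac s) i j| <= 2^-1 * B.
  move=> bV i j.
  have B0 : 0 <= B by apply: le_trans (bV i j).
  have : `|(V *m Ac s) i j| <= n.+1%:R * C * B.
    rewrite mxE; apply: le_trans (ler_norm_sum _ _ _) _.
    apply: (@le_trans _ _ (\sum_(l < n) (C * B))).
      by apply: ler_sum => l _; rewrite normrM mulrC ler_pM.
    rewrite sumr_const card_ord -[X in X <= _]mulr_natl -mulrA ler_wpM2r ?ler_nat //.
    by rewrite mulr_ge0 // ltW.
  move=> /(ler_wpM2l (ltW h_gt0)) /le_trans; apply.
  by rewrite mulrA ler_wpM2r.
have int_le (V W : R -> 'M[R]_n) B : 
    (forall i j, continuous (fun s => V s i j)) ->
    (forall i j, continuous (fun s => W s i j)) ->
    (forall s i j, `|V s i j - W s i j| <= B) ->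
    forall s i j, `|P (fun s => (V s *m Ac s) i j) s - P (fun s => (W s *m Ac s) i j) s| <= 2^-1 * B.
  move=> cV cW VW s i j.
  have -> : 2^-1 * B = h * (h^-1 * (2^-1 * B)) by rewrite mulVKf // lt0r_neq0.
  apply: P2 => [||t]; [exact: cmul|exact: cmul|].
  rewrite -(ler_pM2l h_gt0) mulVKf ?lt0r_neq0 //.
  have -> : (V t *m Ac t) i j - (W t *m Ac t) i j = ((V t - W t) *m Ac t) i j.
    by rewrite mulmxBl !mxE.
  by apply: bmul => k l; rewrite !mxE.
pose u := fix u k : R -> 'M[R]_n := if k is k'.+1 then
  fun s => 1%:M + \matrix_(i, j) P (fun s => (u k' s *m Ac s) i j) s else fun=> 1%:M.
have uE k s i j : u k.+1 s i j =
    (1%:M : 'M[R]_n) i j + P (fun s => (u k s *m Ac s) i j) s.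
  by rewrite /= !mxE.
have cu k i j : continuous (fun s => u k s i j).
  elim: k i j => [|k IHk] i j s /=; first exact: cvg_cst.
  under eq_fun do rewrite !mxE.
  apply: cvgD; first exact: cvg_cst.
  by have [cP _ _] := P1 _ (cmul _ IHk i j); exact: cP.
have uS k s i j : `|u k.+1 s i j - u k s i j| <= 1 * 2^-1 ^+ k.
  elim: k s i j => [|k IHk] s i j.
    rewrite /= !mxE addrAC subrr add0r expr0 mulr1.
    have Z : (fun s => ((0 : 'M[R]_n) *m Ac s) i j) = fun=> 0.
      by apply/funext => t; rewrite mul0mx mxE.
    have := int_le (fun=> 1%:M) (fun=> 0) 1 _ _ _ s i j.
    rewrite Z P3 subr0 mulr1 => H; apply: le_trans (H _ _ _) _.
    - by move=> ? ? ?; exact: cvg_cst.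
    - by move=> ? ? ?; exact: cvg_cst.
    - by move=> t k l; rewrite !mxE subr0; case: eqP; rewrite ?normr1 ?normr0.
    - by rewrite invf_le1 // ler1n.
  rewrite uE [u k.+1 s i j]uE opprD addrACA subrr add0r exprS mul1r.
  apply: int_le => [||t k' l]; [exact: cu|exact: cu|].
  by have := IHk t k' l; rewrite mul1r.
have lim_ex s i j := geometric_cauchy ler01 (fun k => uS k s i j).
pose U s : 'M[R]_n := \matrix_(i, j) projT1 (cid (lim_ex s i j)).
have UP k s i j : `|U s i j - u k s i j| <= 2 * 2^-1 ^+ k.
  by rewrite mxE; case: (cid _) => l /= /(_ k); rewrite mulr1.
have cU i j : continuous (fun s => U s i j).
  apply: (@uniform_limit_geometric_continuous (fun k s => u k s i j) _ 2).
    by move=> k; exact: cu.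
  by move=> k s; exact: UP.
(* The defect in the integral equation is at most 2^(1-k) for every k: one half comes from U against
   the iterate k + 1, the other from the contraction applied to U and the iterate k. *)
have UE s i j : U s i j = (1%:M : 'M[R]_n) i j + P (fun s => (U s *m Ac s) i j) s.
  apply/eqP; rewrite -subr_eq0 -normr_le0 leNgt; apply/negP => H.
  have [k hk] := geometric_small 2 H.
  move: hk; rewrite ltNge => /negP; apply.
  have h1 := UP k.+1 s i j.
  have h2 := int_le _ _ _ cU (cu k) (UP k) s i j.
  rewrite uE exprS in h1; rewrite distrC in h2.
  set d := (1%:M : 'M[R]_n) i j in h1 *.
  have tri (m p q : R) : m - (d + p) = (m - (d + q)) + (q - p) by ring.
  rewrite (tri _ _ (P (fun s => (u k s *m Ac s) i j) s)).
  apply: le_trans (ler_normD _ _) _; apply: le_trans (lerD h1 h2) _.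
  lra.
have U0 : U 0 = 1%:M.
  apply/matrixP => i j; rewrite UE.
  by have [_ -> _] := P1 _ (cmul _ cU i j); rewrite addr0.
have dU s i j : - h < s < h ->
    is_derive s (1 : R) (fun s => U s i j) ((U s *m A s) i j).
  move=> sh; have [_ _ /(_ _ sh) dP] := P1 _ (cmul _ cU i j).
  have -> : (fun s => U s i j) =
      (fun s => (1%:M : 'M[R]_n) i j + P (fun s => (U s *m Ac s) i j) s).
    by apply/funext => t; exact: UE.
  have := is_deriveD (is_derive_cst ((1%:M : 'M[R]_n) i j) s (1 : R)) dP.
  by rewrite add0r /Ac clampE.
(* The equation U' = U A expresses the derivative through U itself, so each order of smoothness
   gives the next. *)
have CU k i j : Ck k `]- h, h[%classic (fun s => U s i j).
  elim: k i j => [|k IHk] i j; first by move=> s _; exact: cU.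
  have oI : open (`]- h, h[%classic : set R) by exact: itv_open.
  have dd s : `]- h, h[%classic s ->
      is_derive s (1 : R) (fun t => U t i j) ((U s *m A s) i j).
    by rewrite /= in_itv /=; exact: dU.
  refine (Ck_derive1 oI dd _).
  apply: (@Ck_ext _ _ _ _ _ (fun s => \sum_l U s i l * A s l j)) => //.
    by move=> s _; rewrite mxE.
  apply: Ck_sum => // l; apply: Ck_mul => //.
  apply: Ck_sub (sA l j k) => s; rewrite /= !in_itv /=; lra.
exists h, U; split=> //.
- by rewrite h_gt0 ltW.
- by move=> i j k; exact: CU.
- by move=> s sh i j; exact: dU.
Qed.

End real_analysis.

Section ode_inverse.
Context {R : realType}.

Lemma is_derive_mulmx n (U V : R -> 'M[R]_n) (dU dV : 'M[R]_n) (s : R) :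
  (forall i j, is_derive s (1 : R) (fun s => U s i j) (dU i j)) ->
  (forall i j, is_derive s (1 : R) (fun s => V s i j) (dV i j)) ->
  forall i j, is_derive s (1 : R) (fun s => (U s *m V s) i j)
    ((dU *m V s + U s *m dV) i j).
Proof.
move=> hU hV i j.
have -> : (fun s => (U s *m V s) i j) =
    \sum_l ((fun s => U s i l) * (fun s => V s l j)).
  by apply/funext => t; rewrite fct_sumE mxE.
have -> : (dU *m V s + U s *m dV) i j =
    \sum_l (U s i l *: dV l j + V s l j *: dU i l).
  rewrite !mxE -big_split; apply: eq_bigr => l _ /=.
  by rewrite /GRing.scale /= addrC [V s l j * _]mulrC.
by apply: is_derive_sum => l; exact: is_deriveM.
Qed.

(* The inverse of the fundamental solution solves the adjoint equation. *)
Lemma linear_ode_inv n (A : R -> 'M[R]_n) (r : R) : 0 < r ->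
  (forall i j, smooth_on `]- r, r[%classic (fun s => A s i j)) ->
  exists h : R, exists U W : R -> 'M[R]_n,
    [/\ 0 < h <= r, U 0 = 1%:M, W 0 = 1%:M,
        (forall i j, smooth_on `]- h, h[%classic (fun s => U s i j)) &
        forall s, - h < s < h ->
        [/\ U s *m W s = 1%:M,
          forall i j, is_derive s (1 : R) (fun s => U s i j) ((U s *m A s) i j) &
          forall i j, is_derive s (1 : R) (fun s => W s i j) (- (A s *m W s) i j)]].
Proof.
move=> r0 sA.
have [h1 [U [h1r U0 sU dU]]] := linear_ode r0 sA.
(* Transposition turns W' = -A W into an equation with multiplication on the right, so W is the
   transpose of the solution with coefficient -A^T. *)
have sA' i j : smooth_on `]- r, r[%classic (fun s => (- (A s)^T) i j).
  move=> k; apply: (@Ck_ext _ _ _ _ _ (fun s => - A s j i)).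
  - exact: itv_open.
  - by move=> s _; rewrite !mxE.
  by apply: Ck_opp; [exact: itv_open|exact: sA].
have [h2 [V [h2r V0 _ dV]]] := linear_ode r0 sA'.
have h12 : 0 < Num.min h1 h2 by rewrite lt_min; lra.
have sub s : - Num.min h1 h2 < s < Num.min h1 h2 -> - h1 < s < h1 /\ - h2 < s < h2.
  by rewrite -!ltr_norml lt_min => /andP[].
have dW s : - Num.min h1 h2 < s < Num.min h1 h2 -> forall i j,
    is_derive s (1 : R) (fun s => (V s)^T i j) (- (A s *m (V s)^T) i j).
  move=> /sub[_ /dV d] i j.
  have -> : (fun s => (V s)^T i j) = (fun s => V s j i).
    by apply/funext => t; rewrite mxE.
  have -> : - (A s *m (V s)^T) i j = (V s *m - (A s)^T) j i; last exact: d.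
  by rewrite mulmxN -[in RHS](trmxK (V s)) -trmx_mul !mxE.
exists (Num.min h1 h2), U, (fun s => (V s)^T); split => //.
- by rewrite h12 ge_min; apply/orP; left; lra.
- by rewrite V0 trmx1.
- move=> i j k; apply: Ck_sub (sU i j k) => s; rewrite /= !in_itv /=.
  by move=> /sub[].
move=> s sh; split; last 2 first.
- by have [/dU] := sub _ sh.
- exact: dW.
apply/matrixP => i j.
(* The derivative of U W is U A W - U A W = 0, and U W = 1 at 0. *)
pose q s := (U s *m (V s)^T) i j.
have dq t : - Num.min h1 h2 < t < Num.min h1 h2 -> is_derive t (1 : R) q 0.
  move=> th; have [/dU dUt _] := sub _ th.
  have dVt i' j' : is_derive t (1 : R) (fun s => (V s)^T i' j') ((- (A t *m (V t)^T)) i' j').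
    by rewrite [X in is_derive _ _ _ X]mxE; exact: dW.
  have := is_derive_mulmx dUt dVt i j.
  by rewrite mulmxN mulmxA subrr mxE.
have q0 : q 0 = (1%:M : 'M[R]_n) i j by rewrite /q U0 V0 trmx1 mulmx1.
rewrite -q0 -/(q s); apply/eqP; rewrite -subr_eq0 -normr_le0.
case: (leP 0 s) => s0.
  rewrite -[X in _ <= X](mul0r (s - 0)).
  by apply: (@mean_value_bound _ q (fun=> 0)) => // t ?; [apply: dq; lra|rewrite normr0].
rewrite distrC -[X in _ <= X](mul0r (0 - s)).
by apply: (@mean_value_bound _ q (fun=> 0)) => // [t ?|t ?|]; [apply: dq; lra|rewrite normr0|exact: ltW].
Qed.

End ode_inverse.

(** * Total differential systems *)

Section total_differential_system.
Context {R : realType}.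

Lemma is_derive_line (V : normedModType R) (f : V -> R) (x v : V) (t df : R) :
  is_derive (x + t *: v) v f df <->
  is_derive t (1 : R) (fun s => f (x + s *: v)) df.
Proof.
have E : (fun h : R => h^-1 *: (f (h *: v + (x + t *: v)) - f (x + t *: v))) =
   (fun h : R => h^-1 *: (f (x + (h *: (1 : R) + t) *: v) - f (x + t *: v))).
  apply/funext => h; congr (_ *: (f _ - _)).
  by rewrite scalerDl addrCA /GRing.scale /= mulr1.
split=> -[d1 d2]; apply: DeriveDef; move: d1 d2; rewrite /derivable /derive /=.
- by rewrite E.
- by rewrite E.
- by rewrite -E.
- by rewrite -E.
Qed.

(** The mean value theorem is applied to t -> f(x + t h) - t l(h), where l is the candidate
    differential. Its derivative is the sum of h_k (phi_k(x + t h) - phi_k(x)), small compared with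
    |h| by continuity of the phi_k at x. *)
Lemma is_diff_of_directional n (f : 'rV[R]_n -> R) (phi : 'I_n -> 'rV[R]_n -> R)
    (x : 'rV[R]_n) :
  (forall k, {for x, continuous (phi k)}) ->
  (\forall y \near x, forall v, is_derive y v f (\sum_k v 0 k * phi k y)) ->
  differentiable f x.
Proof.
move=> cphi df.
pose l (v : 'rV[R]_n) : R := \sum_k v 0 k * phi k x.
have ll : linear l.
  move=> a u v; rewrite /l scaler_sumr -big_split; apply: eq_bigr => k _ /=.
  by rewrite !mxE /GRing.scale /= mulrDl mulrA.
pose lm := GRing.isLinear.Build _ _ _ _ l ll.
pose L : {linear 'rV[R]_n -> R} := HB.pack l lm.
suff [] : is_diff x f L by [].
apply: is_diff_eps => [|e e0].
  move=> v; apply: (@Ck_sum _ _ _ 0 setT _ (fun k (v : 'rV[R]_n) => v 0 k * phi k x)) => //.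
    exact: openT.
  move=> k; apply: Ck_mul; [exact: openT| |exact: Ck_cst].
  by apply: Ck_coord; [exact: openT|exact: Ck_id].
have e'0 : 0 < e / n.+1%:R by rewrite divr_gt0.
have near1 : \forall y \near x, forall k, `|phi k x - phi k y| <= e / n.+1%:R.
  have H k : \forall y \near x, `|phi k x - phi k y| <= e / n.+1%:R.
    by have /cvgrPdist_le /(_ _ e'0) := cphi k.
  exact: (@filter_forall _ _ _ (nbhs x) _ H).
have nn : nbhs x [set y | (forall v, is_derive y v f (\sum_k v 0 k * phi k y)) /\
    forall k, `|phi k x - phi k y| <= e / n.+1%:R] by exact: filterI.
move: nn => /nbhs_ballP [d /= d0 db].
have lineP (h : 'rV[R]_n) t : `|h| < d -> 0 <= t <= 1 -> ball x d (x + t *: h).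
  move=> hd /andP[t0 t1]; rewrite -ball_normE /= opprD addNKr normrN normrZ ger0_norm //.
  by apply: le_lt_trans hd; rewrite ler_piMl.
near=> h.
have hd : `|h| < d by near: h; exact: (@nbhs0_lt _ 'rV[R]_n _ d0).
pose g t := f (x + t *: h) - t * l h.
have -> : f (h + x) - f x - L h = g 1 - g 0.
  by rewrite /g scale1r scale0r addr0 mul1r mul0r subr0 [x + h]addrC addrAC.
have dg (t : R) : 0 <= t <= 1 -> is_derive t (1 : R) g
    (\sum_k h 0 k * (phi k (x + t *: h) - phi k x)).
  move=> t01; have [/(_ h) dft _] := db _ (lineP _ _ hd t01).
  have -> : \sum_k h 0 k * (phi k (x + t *: h) - phi k x) =
      \sum_k h 0 k * phi k (x + t *: h) - l h.
    by rewrite -sumrB; apply: eq_bigr => k _; rewrite mulrBr.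
  have d1 := (is_derive_line f x h t _).1 dft.
  have d2 : is_derive t (1 : R) (fun s : R => s * l h) (l h).
    have := is_deriveM (is_derive_id t (1 : R)) (is_derive_cst (l h) t (1 : R)).
    by rewrite scaler0 add0r /GRing.scale /= mulr1.
  exact: (is_deriveB d1 d2).
have := @mean_value_bound _ g _ 0 1 (e * `|h|) dg _ ler01.
rewrite subr0 mulr1; apply => t t01.
have [_ phit] := db _ (lineP _ _ hd t01).
apply: le_trans (ler_norm_sum _ _ _) _.
apply: (@le_trans _ _ (\sum_(k < n) (`|h| * (e / n.+1%:R)))).
  apply: ler_sum => k _; rewrite normrM ler_pM //; last by rewrite distrC.
  rewrite [leRHS]/Num.Def.normr /= mx_normrE.
  exact: (@le_bigmax _ _ _ _ (fun ij : 'I_1 * 'I_n => `|h ij.1 ij.2|) (0, k)).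
rewrite sumr_const card_ord -[_ *+ n]mulr_natl.
have n0 : 0 < n.+1%:R :> R by rewrite ltr0n.
rewrite mulrCA [leRHS]mulrC ler_wpM2l // mulrCA ler_piMr ?(ltW e0) //.
by rewrite ler_pdivrMr // mul1r ler_nat.
Unshelve. all: by end_near. Qed.


Lemma ball_segment (V : normedModType R) (x0 x y : V) (r t : R) :
  ball x0 r x -> ball x0 r y -> 0 <= t <= 1 -> ball x0 r (x + t *: (y - x)).
Proof.
rewrite -!ball_normE /= => bx byy /andP[t0 t1].
have -> : x0 - (x + t *: (y - x)) = (1 - t) *: (x0 - x) + t *: (x0 - y).
  have -> : y - x = (x0 - x) - (x0 - y) by rewrite opprB [RHS]addrC subrKA.
  rewrite opprD addrA; move: (x0 - x) (x0 - y) => a b.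
  by rewrite scalerBr scalerBl scale1r opprB addrA addrAC.
apply: le_lt_trans (ler_normD _ _) _; rewrite !normrZ !ger0_norm ?subr_ge0 //.
apply: (@le_lt_trans _ _ (Num.max `|x0 - x| `|x0 - y|)); last by rewrite gt_max bx.
have -> : Num.max `|x0 - x| `|x0 - y| =
    (1 - t) * Num.max `|x0 - x| `|x0 - y| + t * Num.max `|x0 - x| `|x0 - y|.
  by rewrite -mulrDl subrK mul1r.
by apply: lerD; rewrite ler_wpM2l ?subr_ge0 // le_max lexx ?orbT.
Qed.

Lemma norm_row_coord n (v : 'rV[R]_n) k : `|v 0 k| <= `|v|.
Proof.
rewrite [leRHS]/Num.Def.normr /= mx_normrE.
exact: (@le_bigmax _ _ _ _ (fun ij : 'I_1 * 'I_n => `|v ij.1 ij.2|) (0, k)).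
Qed.

Lemma ler_sum_term (I : finType) (F : I -> R) (i : I) :
  (forall j, 0 <= F j) -> F i <= \sum_j F j.
Proof. by move=> F0; rewrite (bigD1 i) //= lerDl sumr_ge0. Qed.

(* A total differential system, linear and homogeneous in the unknown G: a mean
   value estimate bounds G near each point, so G is continuous, and the system
   then gives one more derivative at each step. *)
Lemma total_differential_smooth n m (G : 'rV[R]_n -> 'M[R]_m)
    (Gam : 'I_n -> 'rV[R]_n -> 'M[R]_m) (B : set 'rV[R]_n) (x0 : 'rV[R]_n) :
  open B -> B x0 -> (forall k i j, smooth_on B (fun x => Gam k x i j)) ->
  (forall x v i j, B x -> is_derive x v (fun x => G x i j)
    (\sum_k v 0 k * (Gam k x *m G x + G x *m (Gam k x)^T) i j)) ->
  exists2 r : R, 0 < r & forall i j, smooth_on (ball x0 r) (fun x => G x i j).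
Proof.
move=> oB Bx0 sGam dG.
pose Phi k x := Gam k x *m G x + G x *m (Gam k x)^T.
have cGam k i j (x : 'rV[R]_n) : B x -> {for x, continuous (fun x => Gam k x i j)}.
  exact: (sGam k i j 0%N).
pose C : R := 1 + \sum_k \sum_i \sum_j `|Gam k x0 i j|.
have C0 : 0 < C.
  by rewrite ltr_pwDl // sumr_ge0 // => k _; rewrite sumr_ge0 // => i _; rewrite sumr_ge0.
have GamC k i j : `|Gam k x0 i j| < C.
  rewrite ltr_pwDl //.
  apply: le_trans (ler_sum_term (F := fun j => `|Gam k x0 i j|) j _) _ => //.
  apply: le_trans (ler_sum_term (F := fun i => \sum_j `|Gam k x0 i j|) i _) _.
    by move=> l; exact: sumr_ge0.
  apply: (ler_sum_term (F := fun k => \sum_i \sum_j `|Gam k x0 i j|)) => l.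
  by apply: sumr_ge0 => l' _; exact: sumr_ge0.
have [r0 r00 rB] : exists2 r0 : R, 0 < r0 & forall x, ball x0 r0 x ->
    B x /\ forall k i j, `|Gam k x i j| <= C.
  have H (kij : 'I_n * ('I_m * 'I_m)) :
      \forall x \near x0, `|Gam kij.1 x kij.2.1 kij.2.2| < C.
    case: kij => k [i j] /=.
    exact: (cvgr_norm_lt _ (cGam k i j _ Bx0) C (GamC k i j)).
  have HF : \forall x \near x0, forall kij : 'I_n * ('I_m * 'I_m),
      `|Gam kij.1 x kij.2.1 kij.2.2| < C.
    exact: (@filter_forall _ _ _ (nbhs x0) _ H).
  have nB : nbhs x0 B by exact: open_nbhs_nbhs.
  have nn : nbhs x0 [set x | B x /\ forall kij : 'I_n * ('I_m * 'I_m),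
    `|Gam kij.1 x kij.2.1 kij.2.2| < C].
    by near=> x; split; near: x.
  move: nn => /nbhs_ballP [d /= d0 db]; exists d => // x /db[Bx hx]; split=> // k i j.
  by have /ltW := hx (k, (i, j)).
(* The sum of all entries in absolute value dominates row sums and column sums, which are what the
   two products in [Phi] involve. *)
pose N (x : 'rV[R]_n) : R := \sum_i \sum_j `|G x i j|.
have N0 x : 0 <= N x by rewrite sumr_ge0 // => i _; rewrite sumr_ge0.
have colN x j : \sum_l `|G x l j| <= N x.
  apply: ler_sum => l _.
  exact: (ler_sum_term (F := fun j => `|G x l j|)).
have rowN x i : \sum_l `|G x i l| <= N x.
  by apply: (ler_sum_term (F := fun i => \sum_l `|G x i l|)) => l; exact: sumr_ge0.
have PhiN k (x : 'rV[R]_n) i j : ball x0 r0 x -> `|Phi k x i j| <= 2 * C * N x.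
  move=> /rB[_ GC]; rewrite !mxE (_ : 2 * C * N x = C * N x + C * N x); last by ring.
  apply: le_trans (ler_normD _ _) (lerD _ _); apply: le_trans (ler_norm_sum _ _ _) _.
    apply: le_trans (ler_wpM2l (ltW C0) (colN x j)); rewrite mulr_sumr.
    by apply: ler_sum => l _; rewrite normrM ler_pM.
  apply: le_trans (ler_wpM2l (ltW C0) (rowN x i)); rewrite mulr_sumr.
  by apply: ler_sum => l _; rewrite normrM mxE mulrC ler_pM.
pose K : R := n%:R * (2 * C).
have K0 : 0 <= K by rewrite mulr_ge0 // mulr_ge0 // ltW.
have dN (v x : 'rV[R]_n) i j : ball x0 r0 x -> `|\sum_k (v 0 k * Phi k x i j)| <= K * `|v| * N x.
  move=> bx; apply: le_trans (ler_norm_sum _ _ _) _.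
  apply: (@le_trans _ _ (\sum_(k < n) (`|v| * (2 * C * N x)))).
    by apply: ler_sum => k _; rewrite normrM ler_pM ?norm_row_coord ?PhiN.
  rewrite sumr_const card_ord -[_ *+ n]mulr_natl /K le_eqVlt.
  by apply/orP; left; apply/eqP; ring.
have lineG (x v : 'rV[R]_n) (t : R) i j : ball x0 r0 (x + t *: v) ->
    is_derive t (1 : R) (fun s => G (x + s *: v) i j)
      (\sum_k v 0 k * Phi k (x + t *: v) i j).
  by move=> bx; apply/(is_derive_line (fun x => G x i j)); apply: dG; case: (rB _ bx).
(* Within distance 1/KK the m^2 entries of G together change by at most half the maximum of N. The
   summand 1 keeps [KK] positive. *)
pose KK : R := 2 * (m%:R * m%:R * K + 1).
have mmK : 0 <= m%:R * m%:R * K by apply: mulr_ge0 => //; rewrite mulr_ge0 ?ler0n.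
have KK0 : 0 < KK by rewrite mulr_gt0 // ltr_pwDr.
pose r := Num.min r0 KK^-1.
have r_gt0 : 0 < r by rewrite lt_min r00 invr_gt0.
have rr0 (x : 'rV[R]_n) : ball x0 r x -> ball x0 r0 x.
  by apply: le_ball; rewrite ge_min lexx.
have rK : m%:R * m%:R * K * r <= 2^-1.
  have rKK : r * KK <= 1 by rewrite -ler_pdivlMr // div1r ge_min lexx orbT.
  by move: rKK; rewrite /KK; nra.
have bx0 : ball x0 r x0 by exact: ballxx.
have NB (x : 'rV[R]_n) : ball x0 r x -> N x <= 2 * N x0.
  move=> bx; pose w := x - x0.
  have wr : `|w| < r by move: bx; rewrite -ball_normE /= distrC.
  have bl (t : R) : 0 <= t <= 1 -> ball x0 r (x0 + t *: w) by exact: ball_segment.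
  pose g (t : R) := N (x0 + t *: w).
  (* N is not known to be bounded on the ball, but it is continuous along the segment and so attains
     a maximum there, at c. The mean value estimate gives g(c) <= N(x0) + g(c)/2, hence g(c) <= 2
     N(x0), a bound that does not depend on the segment. *)
  have [c] : exists2 c : R, c \in `[0, 1] & forall t, t \in `[0, 1] -> g t <= g c.
    apply: EVT_max => //; apply: continuous_in_subspaceT => t.
    rewrite inE /= in_itv /= => t01.
    apply: cvg_big => [|i _]; first exact: add_continuous.
    apply: cvg_big => [|j _]; first exact: add_continuous.
    apply: cvg_norm; apply: is_derive_continuous.
    by apply: lineG; exact/rr0/bl.
  rewrite in_itv /= => /andP[c0 c1] gmax.
  have gmax' (t : R) : 0 <= t <= 1 -> g t <= g c by move=> ?; apply: gmax; rewrite in_itv.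
  suff : g c <= 2 * N x0.
    apply: le_trans; have := gmax' 1; rewrite /g scale1r addrC subrK; apply.
    by rewrite ler01 lexx.
  have step i j : `|G (x0 + c *: w) i j - G x0 i j| <= K * r * g c.
    have dd (t : R) : 0 <= t <= c -> is_derive t (1 : R) (fun s => G (x0 + s *: w) i j)
        (\sum_k w 0 k * Phi k (x0 + t *: w) i j).
      by move=> tc; apply: lineG; apply/rr0/bl; lra.
    have bb (t : R) : 0 <= t <= c -> `|\sum_k w 0 k * Phi k (x0 + t *: w) i j| <= K * r * g c.
      move=> tc; apply: le_trans (dN _ _ _ _ _) _; first by apply/rr0/bl; lra.
      apply: ler_pM => //; first exact: mulr_ge0.
        by rewrite ler_wpM2l // ltW.
      by apply: gmax'; lra.
    have := mean_value_bound dd bb c0; rewrite scale0r addr0 subr0 => /le_trans; apply.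
    by rewrite ler_piMr // !mulr_ge0 ?N0 // ltW.
  have : g c <= N x0 + m%:R * m%:R * (K * r * g c).
    have -> : m%:R * m%:R * (K * r * g c) = \sum_(i < m) \sum_(j < m) (K * r * g c).
      by rewrite !sumr_const !card_ord -mulrnA -[RHS]mulr_natl natrM.
    rewrite /N -big_split; apply: ler_sum => i _ /=.
    rewrite -big_split; apply: ler_sum => j _ /=.
    rewrite -lerBlDl; apply: le_trans (step i j).
    by apply: le_trans (ler_norm _) _; exact: ler_dist_dist.
  have g0 : 0 <= g c by exact: N0.
  have h := ler_wpM2r g0 rK.
  have -> : m%:R * m%:R * (K * r * g c) = m%:R * m%:R * K * r * g c by ring.
  move=> h'; lra.
(* The uniform bound on N turns the mean value estimate into a Lipschitz bound between points of the
   ball. *)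
have cG i j (x : 'rV[R]_n) : ball x0 r x -> {for x, continuous (fun x => G x i j)}.
  move=> bx; apply/(@cvgrPdist_le _ _ _ (nbhs x) _ (fun y => G y i j)) => e e0.
  pose L := K * (2 * N x0) + 1.
  have L0 : 0 < L by rewrite ltr_pwDr // mulr_ge0 // mulr_ge0.
  near=> y.
  have byy : ball x0 r y.
    by near: y; apply: open_nbhs_nbhs; split => //; exact: ball_open.
  have dd (t : R) : 0 <= t <= 1 -> is_derive t (1 : R) (fun s => G (x + s *: (y - x)) i j)
      (\sum_k (y - x) 0 k * Phi k (x + t *: (y - x)) i j).
    by move=> t01; apply: lineG; apply/rr0; exact: ball_segment.
  have bb (t : R) : 0 <= t <= 1 -> `|\sum_k (y - x) 0 k * Phi k (x + t *: (y - x)) i j| <=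
      K * `|y - x| * (2 * N x0).
    move=> t01; have bt : ball x0 r (x + t *: (y - x)) by exact: ball_segment.
    apply: le_trans (dN _ _ _ _ (rr0 _ bt)) _.
    by apply: ler_wpM2l; [exact: mulr_ge0|exact: NB].
  have := mean_value_bound dd bb ler01.
  rewrite scale1r scale0r addr0 [x + _]addrC subrK subr0 mulr1 distrC => /le_trans; apply.
  have yx : `|y - x| <= e / L.
    rewrite distrC; near: y; apply: cvgr_dist_le; last exact: divr_gt0.
    exact: cvg_id.
  apply: (@le_trans _ _ (L * `|y - x|)).
    by rewrite mulrAC ler_wpM2r // lerDl.
  by rewrite mulrC -ler_pdivlMr.
have oball : open (ball x0 r) by exact: ball_open.
have CPhi N' k i j : (forall i j, Ck N' (ball x0 r) (fun x => G x i j)) ->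
    Ck N' (ball x0 r) (fun x => Phi k x i j).
  move=> CG.
  have -> : (fun x => Phi k x i j) = fun x =>
      \sum_l Gam k x i l * G x l j + \sum_l G x i l * Gam k x j l.
    apply/funext => y; rewrite !mxE; congr (_ + _).
    by apply: eq_bigr => l _; rewrite mxE.
  have CGam i' j' : Ck N' (ball x0 r) (fun x => Gam k x i' j').
    by apply: Ck_sub (sGam k i' j' N') => x /rr0 /rB[].
  by apply: Ck_add => //; apply: Ck_sum => // l; exact: Ck_mul.
exists r => // i j N'; elim: N' i j => [|N' IH] i j.
  by move=> x bx; exact: cG.
split=> [x bx|v].
  apply: (@is_diff_of_directional _ _ (fun k x => Phi k x i j)).
    by move=> k; apply: (CPhi 0%N k i j) => // ? ? y by'; exact: cG.
  near=> y => v; apply: dG; have [] // := rB y; apply: rr0.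
  by near: y; exact: open_nbhs_nbhs.
apply: (@Ck_ext _ _ _ _ _ (fun x => \sum_k v 0 k * Phi k x i j)) => //.
  by move=> x bx; have [Bx _] := rB _ (rr0 _ bx); have [_ ->] := dG x v i j Bx.
apply: Ck_sum => // k; apply: Ck_mul => //; first exact: Ck_cst.
exact: CPhi.
Unshelve. all: by end_near. Qed.

End total_differential_system.

(** * Charts and vector fields *)

Section charts.
Context {R : realType} {n : nat} (M : smooth_manifold R n).
Implicit Types (c d e : chart R n M) (p q : M) (x y v : 'rV[R]_n).

Lemma open_preimage_on (S T : topologicalType) (A : set S) (f : S -> T) (B : set T) :
  open A -> (forall z, A z -> {for z, continuous f}) -> open B ->
  open (A `&` f @^-1` B).
Proof.
move=> oA cf oB; rewrite openE => x [Ax Bfx]; apply: filterI.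
  exact: open_nbhs_nbhs.
by apply: (cf x Ax); exact: open_nbhs_nbhs.
Qed.

Lemma chart_dom_open c : atlas c -> open (chart_dom c).
Proof. by move=> /atlas_is_chart[]. Qed.

Lemma chart_cod_open c : atlas c -> open (chart_cod c).
Proof. by move=> /atlas_is_chart[]. Qed.

Lemma chart_mapK c p : atlas c -> chart_dom c p -> chart_inv c (chart_map c p) = p.
Proof. by move=> /atlas_is_chart[_ _ + _ _]; apply. Qed.

Lemma chart_map_cod c p : chart_dom c p -> chart_cod c (chart_map c p).
Proof. by move=> cp; exists p. Qed.

Lemma chart_inv_dom c x : atlas c -> chart_cod c x -> chart_dom c (chart_inv c x).
Proof. by move=> ac [p cp <-]; rewrite chart_mapK. Qed.

Lemma chart_invK c x : atlas c -> chart_cod c x -> chart_map c (chart_inv c x) = x.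
Proof. by move=> ac [p cp <-]; rewrite chart_mapK. Qed.

Lemma chart_inv_continuous c x : atlas c -> chart_cod c x ->
  {for x, continuous (chart_inv c)}.
Proof. by move=> /atlas_is_chart[_ _ _ _]; apply. Qed.

(** The domain of the transition map from c to d, written as a preimage so that its openness follows
    from continuity of [chart_inv c]. *)
Definition overlap c d : set 'rV[R]_n :=
  chart_cod c `&` chart_inv c @^-1` chart_dom d.

Lemma overlap_open c d : atlas c -> atlas d -> open (overlap c d).
Proof.
move=> ac ad; apply: open_preimage_on; first exact: chart_cod_open.
  by move=> x; exact: chart_inv_continuous.
exact: chart_dom_open.
Qed.

Lemma overlap_map c d p : atlas c -> chart_dom c p -> chart_dom d p ->
  overlap c d (chart_map c p).
Proof.
by move=> ac cp dp; split; [exact: chart_map_cod|rewrite /= chart_mapK].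
Qed.

Lemma overlap_sym c d x : atlas c -> atlas d -> overlap c d x ->
  overlap d c (chart_map d (chart_inv c x)).
Proof.
move=> ac ad [cx dx]; apply: overlap_map => //; exact: chart_inv_dom.
Qed.

Lemma transition_smooth c d k : atlas c -> atlas d ->
  Ck k (overlap c d) (chart_map d \o chart_inv c).
Proof.
move=> ac ad; apply: Ck_sub (atlas_compatible ac ad k) => x [cx dx].
exists (chart_inv c x); last exact: chart_invK.
by split => //; exact: chart_inv_dom.
Qed.

Lemma transition_differentiable c d x : atlas c -> atlas d -> overlap c d x ->
  differentiable (chart_map d \o chart_inv c) x.
Proof. by move=> ac ad; have [+ _] := transition_smooth 1 ac ad; apply. Qed.

Lemma transition_cocycle c d e x : atlas c -> atlas d -> overlap c d x ->
  \near x, (chart_map e \o chart_inv c) x =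
           ((chart_map e \o chart_inv d) \o (chart_map d \o chart_inv c)) x.
Proof.
move=> ac ad ox; have := open_nbhs_nbhs (conj (overlap_open ac ad) ox).
by apply: filterS => y [cy dy] /=; rewrite chart_mapK.
Qed.

Lemma diff_transition_comp c d e x v : atlas c -> atlas d -> atlas e ->
  overlap c d x -> overlap c e x ->
  'd (chart_map e \o chart_inv c) x v =
  'd (chart_map e \o chart_inv d) (chart_map d (chart_inv c x))
    ('d (chart_map d \o chart_inv c) x v).
Proof.
move=> ac ad ae ocd oce.
have ode : overlap d e (chart_map d (chart_inv c x)).
  by case: ocd => _ dx; case: oce => _ ex; exact: overlap_map.
have dce := transition_differentiable ac ae oce.
have dcd := transition_differentiable ac ad ocd.
have dde := transition_differentiable ad ae ode.
have E1 := near_eq_diff (transition_cocycle e ac ad ocd) dce.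
have E2 := diff_comp dcd dde.
exact: (congr1 (fun h : 'rV[R]_n -> 'rV[R]_n => h v) (etrans E1 E2)).
Qed.

Lemma diff_transition_id c x v : atlas c -> chart_cod c x ->
  'd (chart_map c \o chart_inv c) x v = v.
Proof.
move=> ac cx.
have E : \near x, idfun x = (chart_map c \o chart_inv c) x.
  have := open_nbhs_nbhs (conj (chart_cod_open ac) cx).
  by apply: filterS => y cy /=; rewrite chart_invK.
by rewrite -(near_eq_diff E) // diff_val.
Qed.

Section at_point.
Variables (c : chart R n M) (p : M).
Hypotheses (ac : atlas c) (cp : chart_dom c p).

Lemma tangent_coord_linear : linear (tangent_coord c p).
Proof. by move=> a u v; rewrite /tangent_coord linearP. Qed.

Lemma tangent_vec_linear : linear (tangent_vec c p).
Proof. by move=> a u v; rewrite /tangent_vec linearP. Qed.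

Lemma tangent_coordE d v : atlas d -> chart_dom d p ->
  tangent_coord d p v =
  'd (chart_map d \o chart_inv c) (chart_map c p) (tangent_coord c p v).
Proof.
move=> ad dp; rewrite /tangent_coord.
have aa := chart_at_atlas p; have ap := chart_at_dom p.
have := @diff_transition_comp _ c d _ v aa ac ad
  (overlap_map aa ap cp) (overlap_map aa ap dp).
by rewrite chart_mapK.
Qed.

Lemma tangent_vecK y : tangent_coord c p (tangent_vec c p y) = y.
Proof.
have aa := chart_at_atlas p; have ap := chart_at_dom p.
rewrite /tangent_coord /tangent_vec.
have H := @diff_transition_comp c (chart_at p) c (chart_map c p) y ac aa ac
  (overlap_map ac cp ap) (overlap_map ac cp cp).
rewrite chart_mapK // in H.
exact: etrans (esym H) (diff_transition_id y ac (chart_map_cod cp)).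
Qed.

Lemma tangent_coordK v : tangent_vec c p (tangent_coord c p v) = v.
Proof.
have aa := chart_at_atlas p; have ap := chart_at_dom p.
rewrite /tangent_coord /tangent_vec.
have H := @diff_transition_comp (chart_at p) c (chart_at p) _ v aa ac aa
  (overlap_map aa ap cp) (overlap_map aa ap ap).
rewrite chart_mapK // in H.
exact: etrans (esym H) (diff_transition_id v aa (chart_map_cod ap)).
Qed.

Lemma tangent_coord_vec d y : atlas d -> chart_dom d p ->
  tangent_coord d p (tangent_vec c p y) =
  'd (chart_map d \o chart_inv c) (chart_map c p) y.
Proof. by move=> ad dp; rewrite tangent_coordE // tangent_vecK. Qed.

Lemma field_derivE (X : vector_field M) (f : M -> R) :
  differentiable (f \o chart_inv c) (chart_map c p) ->
  field_deriv X f p = 'd (f \o chart_inv c) (chart_map c p) (tangent_coord c p (X p)).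
Proof.
move=> df; have aa := chart_at_atlas p; have ap := chart_at_dom p.
rewrite /field_deriv /tangent_coord.
set a := chart_at p; set x := chart_map a p.
have oac : overlap a c x by exact: overlap_map.
have E : \near x, ((f \o chart_inv c) \o (chart_map c \o chart_inv a)) x =
    (f \o chart_inv a) x.
  have := open_nbhs_nbhs (conj (overlap_open aa ac) oac).
  by apply: filterS => y [ay cy] /=; rewrite chart_mapK.
have cx : (chart_map c \o chart_inv a) x = chart_map c p by rewrite /= chart_mapK.
have dac := transition_differentiable aa ac oac.
have df' : differentiable (f \o chart_inv c) ((chart_map c \o chart_inv a) x).
  by rewrite cx.
have E1 := near_eq_diff E (differentiable_comp dac df').
have E2 := diff_comp dac df'.
have := congr1 (fun h : 'rV[R]_n -> R => h (X p)) (etrans (esym E1) E2).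
by rewrite /= chart_mapK.
Qed.

End at_point.

Lemma Ck_local (V W : normedModType R) k (U0 : set V) (f : V -> W) :
  (forall z, U0 z -> exists U : set V, [/\ open U, U z & Ck k U f]) -> Ck k U0 f.
Proof.
move=> H; apply: Ck_pointwise => x U0x; have [U [_ Ux CU]] := H x U0x.
by apply: Ck_sub CU => y ->.
Qed.

Lemma tangent_coord_sum c p m (a : 'I_m -> R) (v : 'I_m -> 'rV[R]_n) :
  tangent_coord c p (\sum_i a i *: v i) = \sum_i a i *: tangent_coord c p (v i).
Proof.
by rewrite /tangent_coord linear_sum; apply: eq_bigr => i _; rewrite linearZ.
Qed.

Lemma tangent_vec_sum c p m (a : 'I_m -> R) (v : 'I_m -> 'rV[R]_n) :
  tangent_vec c p (\sum_i a i *: v i) = \sum_i a i *: tangent_vec c p (v i).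
Proof.
by rewrite /tangent_vec linear_sum; apply: eq_bigr => i _; rewrite linearZ.
Qed.

Lemma smooth_fun_cst (a : R) : smooth_function (fun _ : M => a).
Proof. by move=> c ac k; exact: Ck_cst. Qed.

Lemma smooth_fun_mul (f g : M -> R) :
  smooth_function f -> smooth_function g -> smooth_function (fun p => f p * g p).
Proof.
move=> sf sg c ac k; apply: Ck_mul; [exact: chart_cod_open|exact: sf|exact: sg].
Qed.

Lemma smooth_field0 : smooth_field (fun _ : M => 0).
Proof.
move=> c ac k.
have -> : (fun x => tangent_coord c (chart_inv c x) 0) = fun=> 0.
  by apply/funext => x; rewrite /tangent_coord linear0.
exact: Ck_cst.
Qed.

Lemma smooth_field_add (X Y : vector_field M) :
  smooth_field X -> smooth_field Y -> smooth_field (X \+ Y).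
Proof.
move=> sX sY c ac k; have oc := chart_cod_open ac.
apply: Ck_ext (Ck_add oc (sX c ac k) (sY c ac k)) => // x _.
by rewrite /tangent_coord linearD.
Qed.

Lemma smooth_field_scale (f : M -> R) (X : vector_field M) :
  smooth_function f -> smooth_field X -> smooth_field (fun p => f p *: X p).
Proof.
move=> sf sX c ac k; have oc := chart_cod_open ac; apply: Ck_row => // j.
apply: Ck_ext (Ck_mul oc (sf c ac k) (Ck_coord j oc (sX c ac k))) => // x _ /=.
by rewrite /tangent_coord linearZ mxE.
Qed.

Lemma smooth_field_sum m (f : 'I_m -> M -> R) (X : 'I_m -> vector_field M) :
  (forall i, smooth_function (f i)) -> (forall i, smooth_field (X i)) ->
  smooth_field (fun p => \sum_i f i p *: X i p).
Proof.
elim: m f X => [|m IHm] f X sf sX.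
  have -> : (fun p => \sum_(i < 0) f i p *: X i p) = fun=> 0.
    by apply/funext => p; rewrite big_ord0.
  exact: smooth_field0.
have -> : (fun p => \sum_(i < m.+1) f i p *: X i p) =
    (fun p => f ord0 p *: X ord0 p) \+
    (fun p => \sum_(i < m) f (lift ord0 i) p *: X (lift ord0 i) p).
  by apply/funext => p; rewrite big_ord_recl.
by apply: smooth_field_add; [exact: smooth_field_scale|exact: IHm].
Qed.

Section extension_by_zero.
Variables (c : chart R n M) (beta : 'rV[R]_n -> R) (K : set 'rV[R]_n).
Hypotheses (ac : atlas c) (sbeta : forall k (V : set 'rV[R]_n), Ck k V beta)
  (compK : compact K) (subK : K `<=` chart_cod c)
  (betaK : forall x, ~ K x -> beta x = 0).

(* Hausdorffness enters here: the support is closed in the manifold. *)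
Lemma outside_support d x : atlas d -> chart_cod d x ->
  ~ chart_dom c (chart_inv d x) -> exists U : set 'rV[R]_n,
    [/\ open U, U x & forall y, U y ->
     chart_dom c (chart_inv d y) -> beta (chart_map c (chart_inv d y)) = 0].
Proof.
move=> ad dx ncx.
have clK : closed (chart_inv c @` K).
  apply: compact_closed; first exact: manifold_hausdorff.
  apply: continuous_compact => //; apply: continuous_in_subspaceT => y.
  by rewrite inE => /subK; exact: chart_inv_continuous.
exists (chart_cod d `&` chart_inv d @^-1` (~` (chart_inv c @` K))); split.
- apply: open_preimage_on; first exact: chart_cod_open.
    by move=> y; exact: chart_inv_continuous.
  by rewrite openC.
- split=> // -[y Ky yx]; apply: ncx; rewrite -yx.
  by apply: chart_inv_dom => //; exact: subK.
move=> y [dy nKy] cy; apply: betaK => Ky; apply: nKy.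
by exists (chart_map c (chart_inv d y)) => //; rewrite chart_mapK.
Qed.

Definition extend_fun (h : 'rV[R]_n -> R) : M -> R := fun q =>
  if q \in chart_dom c then beta (chart_map c q) * h (chart_map c q) else 0.

Definition extend_field (y : 'rV[R]_n) : vector_field M := fun q =>
  if q \in chart_dom c then beta (chart_map c q) *: tangent_vec c q y else 0.

(** Near a point of the domain of c the function is a product read through a transition map; near
    any other point it is zero, because the support is closed. *)
Lemma extend_fun_smooth h : smooth_on (chart_cod c) h ->
  smooth_function (extend_fun h).
Proof.
move=> sh d ad k; apply: Ck_local => x dx.
have [cx|ncx] := pselect (chart_dom c (chart_inv d x)).
  have od := overlap_open ad ac; have oc := chart_cod_open ac.
  exists (overlap d c); split => //.
  have CF : Ck k (chart_cod c) (fun z => beta z * h z).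
    by apply: Ck_mul => //; exact: sh.
  have := Ck_comp od oc _ CF (transition_smooth k ad ac).
  move=> H; apply: Ck_ext (H _) => // [y [dy cy]|y [dy cy]] /=.
    by rewrite /extend_fun mem_set.
  exact: chart_map_cod.
have [U [oU Ux Ub]] := outside_support ad dx ncx.
exists U; split => //; apply: Ck_ext (Ck_cst k U 0) => // y Uy /=.
rewrite /extend_fun; case: ifPn => // /set_mem cy.
by rewrite Ub ?mul0r.
Qed.

Lemma extend_field_coord d q y : atlas d -> chart_dom d q -> chart_dom c q ->
  tangent_coord d q (extend_field y q) =
  beta (chart_map c q) *: 'd (chart_map d \o chart_inv c) (chart_map c q) y.
Proof.
move=> ad dq cq; rewrite /extend_field mem_set // -(tangent_coord_vec ac cq y ad dq).
by rewrite /tangent_coord linearZ.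
Qed.

Lemma extend_field_smooth y : smooth_field (extend_field y).
Proof.
move=> d ad k; apply: Ck_local => x dx.
have [cx|ncx] := pselect (chart_dom c (chart_inv d x)).
  have od := overlap_open ad ac; have oc := overlap_open ac ad.
  exists (overlap d c); split => //.
  have CF : Ck k (overlap c d)
      (fun z => beta z *: 'D_y (chart_map d \o chart_inv c) z).
    apply: Ck_row => // j.
    (* The coordinates of the field involve the differential of the transition map, which costs one
       order. *)
    have [_ /(_ y) CD] := transition_smooth k.+1 ac ad.
    apply: Ck_ext (Ck_mul oc (sbeta _ _) (Ck_coord j oc CD)) => // z _.
    by rewrite mxE.
  have := Ck_comp_row od oc _ CF (transition_smooth k ad ac).
  move=> H; apply: Ck_ext (H _) => // [z oz|z]; last exact: overlap_sym.
  have oz' := overlap_sym ad ac oz.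
  have [dz cz] := oz.
  rewrite extend_field_coord //; last exact: chart_inv_dom.
  by rewrite deriveE //; exact: transition_differentiable.
have [U [oU Ux Ub]] := outside_support ad dx ncx.
exists U; split => //; apply: Ck_ext (Ck_cst k U 0) => // z Uz /=.
rewrite /extend_field; case: ifPn => [/set_mem cz|_].
  by rewrite Ub // scale0r /tangent_coord linear0.
by rewrite /tangent_coord linear0.
Qed.

(* In the usual notation, phi^2 X = sum_i (phi X^i) (phi d/dx^i). *)
Lemma extend_decomposition (X : vector_field M) q :
  extend_fun (fun=> 1) q ^+ 2 *: X q =
  \sum_i extend_fun (fun x => tangent_coord c (chart_inv c x) (X (chart_inv c x)) 0 i) q
    *: extend_field (delta_mx 0 i) q.
Proof.
rewrite /extend_fun /extend_field; case: ifPn => [/set_mem cq|_]; last first.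
  by rewrite expr2 mulr0 big1 => [|i _]; rewrite scale0r.
rewrite mulr1 chart_mapK //.
rewrite -{1}(tangent_coordK ac cq (X q)) {1}(row_sum_delta (tangent_coord c q (X q))).
rewrite tangent_vec_sum scaler_sumr; apply: eq_bigr => i _.
by rewrite !scalerA; congr (_ *: _); ring.
Qed.

Lemma extend_fun_coord_smooth (X : vector_field M) i : smooth_field X ->
  smooth_function
    (extend_fun (fun x => tangent_coord c (chart_inv c x) (X (chart_inv c x)) 0 i)).
Proof.
move=> sX; apply: extend_fun_smooth => k.
by apply: Ck_coord; [exact: chart_cod_open|exact: sX].
Qed.

End extension_by_zero.

End charts.

(** * Parallel translation along coordinate lines *)

Section covariant_derivative_lemmas.
Context {R : realType} {n : nat} (M : smooth_manifold R n).
Variable D : vector_field M -> vector_field M -> vector_field M.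
Hypothesis covD : covariant_derivative D.
Implicit Types (X Y Z : vector_field M) (c d : chart R n M).

Lemma cov_smooth X Y : smooth_field X -> smooth_field Y -> smooth_field (D X Y).
Proof. by case: covD => + _ _ _ _; apply. Qed.

Lemma cov_addl X X' Y p : smooth_field X -> smooth_field X' -> smooth_field Y ->
  D (X \+ X') Y p = D X Y p + D X' Y p.
Proof. by case: covD => _ H _ _ _ sX sX' sY; rewrite H. Qed.

Lemma cov_scalel f X Y p : smooth_function f -> smooth_field X -> smooth_field Y ->
  D (fun p => f p *: X p) Y p = f p *: D X Y p.
Proof. by case: covD => _ _ H _ _ sf sX sY; rewrite H. Qed.

Lemma cov_addr X Y Y' p : smooth_field X -> smooth_field Y -> smooth_field Y' ->
  D X (Y \+ Y') p = D X Y p + D X Y' p.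
Proof. by case: covD => _ _ _ H _ sX sY sY'; rewrite H. Qed.

Lemma cov_scaler f X Y p : smooth_function f -> smooth_field X -> smooth_field Y ->
  D X (fun p => f p *: Y p) p = field_deriv X f p *: Y p + f p *: D X Y p.
Proof. by case: covD => _ _ _ _ H sf sX sY; rewrite H. Qed.

Lemma cov_suml m (a : 'I_m -> R) (X : 'I_m -> vector_field M) Y p :
  (forall i, smooth_field (X i)) -> smooth_field Y ->
  D (fun p => \sum_i a i *: X i p) Y p = \sum_i a i *: D (X i) Y p.
Proof.
move=> sX sY; elim: m a X sX => [|m IHm] a X sX.
  rewrite big_ord0.
  have -> : (fun p => \sum_(i < 0) a i *: X i p) = (fun p => 0 *: (fun=> 0 : 'rV[R]_n) p).
    by apply/funext => q; rewrite big_ord0 scale0r.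
  rewrite cov_scalel ?scale0r //; [exact: smooth_fun_cst|exact: smooth_field0].
have -> : (fun p => \sum_(i < m.+1) a i *: X i p) =
    (fun p => a ord0 *: X ord0 p) \+
    (fun p => \sum_(i < m) a (lift ord0 i) *: X (lift ord0 i) p).
  by apply/funext => q; rewrite big_ord_recl.
rewrite cov_addl //; last 2 first.
- by apply: smooth_field_scale => //; exact: smooth_fun_cst.
- apply: (@smooth_field_sum _ _ _ _ (fun i _ => a (lift ord0 i))) => // i.
  exact: smooth_fun_cst.
rewrite big_ord_recl IHm //; congr (_ + _).
by apply: (@cov_scalel (fun=> a ord0)) => //; exact: smooth_fun_cst.
Qed.

End covariant_derivative_lemmas.

Section coordinate_lines.
Context {R : realType} {n : nat} (M : smooth_manifold R n).
Variable D : vector_field M -> vector_field M -> vector_field M.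
Hypothesis covD : covariant_derivative D.
Variables (c : chart R n M) (beta : 'rV[R]_n -> R) (K B : set 'rV[R]_n).
Hypotheses (ac : atlas c) (sbeta : forall k (V : set 'rV[R]_n), Ck k V beta)
  (compK : compact K) (subK : K `<=` chart_cod c)
  (betaK : forall x, ~ K x -> beta x = 0)
  (subB : B `<=` chart_cod c) (betaB : forall x, B x -> beta x = 1).

Let E := @extend_field R n M c beta.

Let smoothE y : smooth_field (E y).
Proof. exact: (extend_field_smooth ac sbeta compK subK betaK). Qed.

(* Row i holds the components of D_(E_k) E_i.  These are the Christoffel symbols
   only where beta = 1, since elsewhere E_k differs from d/dx^k. *)
Definition christoffel (k : 'I_n) (x : 'rV[R]_n) : 'M[R]_n := \matrix_(i, j)
  tangent_coord c (chart_inv c x)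
    (D (E (delta_mx 0 k)) (E (delta_mx 0 i)) (chart_inv c x)) 0 j.

Lemma christoffel_smooth k i j :
  smooth_on (chart_cod c) (fun x => christoffel k x i j).
Proof.
move=> N; have oc := chart_cod_open ac.
have sD := cov_smooth covD (smoothE (delta_mx 0 k)) (smoothE (delta_mx 0 i)).
by apply: Ck_ext (Ck_coord j oc (sD c ac N)) => // x _; rewrite mxE.
Qed.

Lemma extend_field_B x y : B x ->
  E y (chart_inv c x) = tangent_vec c (chart_inv c x) y.
Proof.
move=> Bx; have cx := subB Bx.
rewrite /E /extend_field mem_set; last exact: chart_inv_dom.
by rewrite chart_invK // betaB // scale1r.
Qed.

(** On all of M, [E v] is the combination of the [E (delta_mx 0 k)] with constant coefficients v_k,
    so linearity of D in its first argument suffices. *)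
Lemma cov_extend v i x :
  tangent_coord c (chart_inv c x) (D (E v) (E (delta_mx 0 i)) (chart_inv c x)) =
  row i (\sum_k v 0 k *: christoffel k x).
Proof.
have -> : E v = fun q => \sum_k v 0 k *: E (delta_mx 0 k) q.
  apply/funext => q; rewrite /E /extend_field; case: ifPn => _; last first.
    by rewrite big1 // => k _; rewrite scaler0.
  rewrite {1}(row_sum_delta v) tangent_vec_sum scaler_sumr.
  by apply: eq_bigr => k _; rewrite !scalerA mulrC.
rewrite cov_suml // tangent_coord_sum; apply/rowP => j.
rewrite [RHS]mxE !summxE; apply: eq_bigr => k _.
by rewrite !mxE.
Qed.

Lemma is_derive_rowmx (U : R -> 'M[R]_n) (dU : 'M[R]_n) (w : 'rV[R]_n) (t : R) :
  (forall i j, is_derive t (1 : R) (fun s => U s i j) (dU i j)) ->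
  forall j, is_derive t (1 : R) (fun s => (w *m U s) 0 j) ((w *m dU) 0 j).
Proof.
move=> dd j.
have -> : (fun s => (w *m U s) 0 j) = \sum_l (w 0 l \*: (fun s => U s l j)).
  by apply/funext => s; rewrite fct_sumE mxE.
by rewrite mxE; apply: is_derive_sum => l; apply: is_deriveZ.
Qed.

Variables (x v : 'rV[R]_n) (h : R) (U : R -> 'M[R]_n).
Let line (s : R) : 'rV[R]_n := x + s *: v.
Let J : set R := `]- h, h[%classic.
Hypotheses (lineB : forall s, J s -> B (line s))
  (sU : forall i j, smooth_on J (fun s => U s i j))
  (dU : forall s, J s -> forall i j, is_derive s (1 : R) (fun s => U s i j)
     ((U s *m - (\sum_k v 0 k *: christoffel k (line s))) i j)).

Let gamma s := chart_inv c (line s).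

Let oJ : open J. Proof. exact: itv_open. Qed.

Lemma Ck_line N (V : set R) : Ck N V line.
Proof.
apply: (@Ck_sub _ _ _ _ _ setT) => //.
apply: Ck_add; [exact: openT|exact: Ck_cst|].
by apply: Ck_scale; [exact: openT|exact: Ck_id].
Qed.

Lemma diff_line (t a : R) : 'd line t a = a *: v.
Proof.
have [dl dE] : is_diff t line (fun a : R => a *: v).
  have := is_diffD (is_diff_cst x t) (is_diff_scalel t v).
  by rewrite add0r.
by rewrite dE.
Qed.

Let line_cont t : {for t, continuous line}.
Proof. exact: (Ck_line 0 setT t I). Qed.

Let gamma_cont t : J t -> {for t, continuous gamma}.
Proof.
move=> Jt; apply: (@continuous_comp _ _ _ line (chart_inv c)); first exact: line_cont.
by apply: chart_inv_continuous => //; exact/subB/lineB.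
Qed.

Let overlap_line d t : (J `&` gamma @^-1` chart_dom d) t -> overlap c d (line t).
Proof. by move=> [Jt dt]; split => //; exact/subB/lineB. Qed.

Let open_J d : atlas d -> open (J `&` gamma @^-1` chart_dom d).
Proof.
by move=> ad; apply: open_preimage_on => //; exact: chart_dom_open.
Qed.

Lemma line_smooth_curve : smooth_curve J gamma.
Proof.
split=> [t Jt|d ad N]; first exact: gamma_cont.
apply: (Ck_comp_row (open_J ad) (overlap_open ac ad) _ (transition_smooth N ac ad)).
  by move=> t; exact: overlap_line.
exact: Ck_line.
Qed.

Lemma line_velocity t : J t -> velocity gamma t = tangent_vec c (gamma t) v.
Proof.
move=> Jt; rewrite /velocity; set a := chart_at (gamma t).
have aa : atlas a by exact: chart_at_atlas.
have oat : overlap c a (line t) by apply: overlap_line; split => //; exact: chart_at_dom.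
have dl : differentiable line t by have [+ _] := Ck_line 1 setT; apply.
have dt := transition_differentiable ac aa oat.
have dc := differentiable_comp dl dt.
rewrite [LHS](derive1E' dc).
have := congr1 (fun f : R -> 'rV[R]_n => f 1) (diff_comp dl dt).
move=> /= ->; rewrite diff_line scale1r /tangent_vec -/a.
by rewrite /gamma chart_invK //; exact/subB/lineB.
Qed.

Variable w : 'rV[R]_n.
Let Vw s := tangent_vec c (gamma s) (w *m U s).

Lemma line_smooth_field : smooth_field_along J gamma Vw.
Proof.
move=> d ad N.
have oJd := open_J ad.
have ocd := overlap_open ac ad.
have CU i : Ck N (J `&` gamma @^-1` chart_dom d) (fun s => (w *m U s) 0 i).
  apply: (@Ck_ext _ _ _ _ _ (fun s => \sum_l w 0 l * U s l i)) => //.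
    by move=> s _; rewrite mxE.
  apply: Ck_sum => // l; apply: Ck_mul => //; first exact: Ck_cst.
  by apply: Ck_sub (sU l i N) => s [].
have CT i : Ck N (J `&` gamma @^-1` chart_dom d)
    (fun s => 'D_(delta_mx 0 i) (chart_map d \o chart_inv c) (line s)).
  have [_ /(_ (delta_mx 0 i)) CD] := transition_smooth N.+1 ac ad.
  apply: (Ck_comp_row oJd ocd _ CD) => //; last exact: Ck_line.
  by move=> t; exact: overlap_line.
apply: Ck_row => // j.
have := Ck_sum oJd (fun i => Ck_mul oJd (CU i) (Ck_coord j oJd (CT i))).
apply: Ck_ext => // s os.
have ol := overlap_line os; have [cl dl] := ol; have [Js _] := os.
rewrite /Vw (tangent_coord_vec ac _ _ ad dl); last exact: chart_inv_dom.
rewrite chart_invK // [in RHS](row_sum_delta (w *m U s)) linear_sum summxE.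
apply: eq_bigr => i _; rewrite linearZ /= [RHS]mxE deriveE //.
exact: transition_differentiable.
Qed.

(** In the frame, the covariant derivative of the field with coordinates wU is (wU)' + (wU)Q with Q
    the sum of the v_k Gamma_k; the equation U' = -UQ makes it vanish. *)
Lemma line_parallel t : J t -> covariant_derivative_along D gamma Vw t 0.
Proof.
move=> Jt; have Bt := lineB Jt.
have df i : is_derive t (1 : R) (fun s => (w *m U s) 0 i)
  ((w *m (U t *m - (\sum_k v 0 k *: christoffel k (line t)))) 0 i).
  by apply: is_derive_rowmx; exact: dU.
(* On [B] the cutoff is 1, so along the line the extended fields are the coordinate frame and [E v]
   extends the velocity. *)
exists n, (fun i => E (delta_mx 0 i)), (fun i s => (w *m U s) 0 i), (E v); split.
- by move=> i; split; [exact: smoothE|have [] := df i].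
- exact: smoothE.
- by rewrite line_velocity // extend_field_B.
- have nJ : nbhs t J by exact: open_nbhs_nbhs.
  apply: filterS nJ => s Js.
  rewrite /Vw {1}(row_sum_delta (w *m U s)) tangent_vec_sum.
  by apply: eq_bigr => i _; rewrite extend_field_B //; exact: lineB.
have gd : chart_dom c (gamma t) by apply: chart_inv_dom => //; exact: subB.
apply/esym; set S := \sum_i _.
suff S0 : tangent_coord c (gamma t) S = 0.
  by rewrite -(tangent_coordK ac gd S) S0 /tangent_vec linear0.
rewrite /S /tangent_coord linear_sum; apply/rowP => j; rewrite summxE [RHS]mxE.
transitivity (\sum_i (
   (w *m (U t *m - (\sum_k v 0 k *: christoffel k (line t)))) 0 i * (delta_mx 0 i : 'rV[R]_n) 0 j +
   (w *m U t) 0 i * (\sum_k v 0 k *: christoffel k (line t)) i j)).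
  apply: eq_bigr => i _; rewrite linearD !linearZ -!/(tangent_coord c (gamma t) _).
  rewrite cov_extend // extend_field_B // (tangent_vecK ac gd) derive1E.
  by have [_ ->] := df i; rewrite !mxE.
rewrite big_split /=.
set Q := \sum_k v 0 k *: christoffel k (line t).
have -> : \sum_i (w *m (U t *m - Q)) 0 i * (delta_mx 0 i : 'rV[R]_n) 0 j =
    (w *m (U t *m - Q)) 0 j.
  by rewrite [in RHS](row_sum_delta (w *m (U t *m - Q))) summxE; apply: eq_bigr => i _; rewrite [RHS]mxE.
by rewrite mulmxA mulmxN mxE [X in - X + _]mxE addNr.
Qed.

Lemma line_parallel_translation s : 0 < h -> J s ->
  parallel_translation D gamma 0 s (tangent_vec c (gamma 0) (w *m U 0)) (Vw s).
Proof.
move=> h0 Js; exists (- h), h, Vw; split => //.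
- by split => //; rewrite /= in_itv /= oppr_lt0 h0.
- exact: line_smooth_curve.
- exact: line_smooth_field.
- exact: line_parallel.
Qed.

End coordinate_lines.

(** * The Loewner metric *)

Section loewner_metric.
Context {R : realType} {n : nat} (M : smooth_manifold R n).
Variables (F : M -> 'rV[R]_n -> R)
  (D : vector_field M -> vector_field M -> vector_field M)
  (gL : forall p : M, 'rV[R]_n -> 'rV[R]_n -> R).
Hypotheses (bmD : berwald_matveev F D)
  (gLP : forall p, scalar_product (gL p) /\
     loewner_ellipsoid (gauge_ball (F p)) (ellipsoid (gL p))).
Implicit Types (X Y Z : vector_field M) (c d : chart R n M).

Let covD : covariant_derivative D. Proof. by case: bmD. Qed.

Lemma linear_matrix (f : 'rV[R]_n -> 'rV[R]_n) : linear f ->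
  exists P : 'M[R]_n, forall v, v *m P = f v.
Proof.
move=> lf; pose m := GRing.isLinear.Build _ _ _ _ f lf.
pose L : {linear 'rV[R]_n -> 'rV[R]_n} := HB.pack f m.
by exists (lin1_mx L) => v; rewrite mul_rV_lin1.
Qed.

Lemma congruence_inverse (A B U W : 'M[R]_n) :
  U *m W = 1%:M -> U *m B *m U^T = A -> B = W *m A *m W^T.
Proof.
move=> /mulmx1C WU <-; rewrite !mulmxA WU mul1mx -!mulmxA -trmx_mul WU.
by rewrite trmx1 mulmx1.
Qed.

Lemma tangent_matrices c p : atlas c -> chart_dom c p ->
  exists P Q : 'M[R]_n, [/\ forall v, v *m P = tangent_vec c p v,
    forall v, v *m Q = tangent_coord c p v, P \in unitmx & Q \in unitmx].
Proof.
move=> ac cp.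
have [P PE] := linear_matrix (tangent_vec_linear c p).
have [Q QE] := linear_matrix (tangent_coord_linear c p).
have PQ : P *m Q = 1%:M.
  by apply/row_matrixP => i; rewrite rowE mulmxA row1 PE QE (tangent_vecK ac cp).
by have [uP uQ] := mulmx1_unit PQ; exists P, Q.
Qed.

(** The ellipsoids at p and q are given in the coordinates of [chart_at p] and [chart_at q], whereas
    transport is computed in c. The matrix T reads U between the former coordinates and carries one
    gauge ball onto the other. *)
Lemma loewner_transport c p q (U : 'M[R]_n) : atlas c ->
  chart_dom c p -> chart_dom c q -> U \in unitmx ->
  (forall w, F q (tangent_vec c q (w *m U)) = F p (tangent_vec c p w)) ->
  forall y z, gL q (tangent_vec c q (y *m U)) (tangent_vec c q (z *m U)) =
              gL p (tangent_vec c p y) (tangent_vec c p z).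
Proof.
move=> ac cp cq uU FU.
have [P [Q [PE QE uP uQ]]] := tangent_matrices ac cp.
have [P' [Q' [PE' QE' uP' uQ']]] := tangent_matrices ac cq.
pose T := Q *m U *m P'.
have uT : T \in unitmx by rewrite !unitmx_mul uQ uU uP'.
have TE v : v *m T = tangent_vec c q (tangent_coord c p v *m U).
  by rewrite /T !mulmxA QE PE'.
have [spp lp] := gLP p; have [spq lq] := gLP q.
have KT v : gauge_ball (F q) (v *m T) <-> gauge_ball (F p) v.
  by rewrite /gauge_ball /= TE FU (tangent_coordK ac cp).
have H := loewner_equivariant uT KT spp spq lp lq.
move=> y z; have := H (tangent_vec c p y) (tangent_vec c p z).
by rewrite !TE !(tangent_vecK ac cp).
Qed.

Definition chart_metric c x : 'M[R]_n := gram (fun y z : 'rV[R]_n =>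
  gL (chart_inv c x) (tangent_vec c (chart_inv c x) y)
                     (tangent_vec c (chart_inv c x) z)).

Lemma chart_metricE c x y z : atlas c -> chart_cod c x ->
  gL (chart_inv c x) (tangent_vec c (chart_inv c x) y)
                     (tangent_vec c (chart_inv c x) z) =
  (y *m chart_metric c x *m z^T) 0 0.
Proof.
move=> ac cx; have [[lg sg pg] _] := gLP (chart_inv c x).
have cp := chart_inv_dom ac cx.
apply: (gramE (b := fun y z : 'rV[R]_n => gL (chart_inv c x)
  (tangent_vec c (chart_inv c x) y) (tangent_vec c (chart_inv c x) z))).
split=> [v a u1 u2|v w|v v0].
- by rewrite tangent_vec_linear lg.
- exact: sg.
- apply: pg; apply: contra v0 => /eqP v0; apply/eqP.
  by rewrite -(tangent_vecK ac cp v) v0 /tangent_coord linear0.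
Qed.

(** Solving U(s) G(x + s v) U(s)^T = G(x) for G(x + s v) puts all dependence on s into W; then W(0)
    = 1 and W'(0) = sum_k v_k Gamma_k(x) give the formula. Each point x of [B] serves as the origin
    of its own line. *)
Lemma chart_metric_derive c (beta : 'rV[R]_n -> R) (K B : set 'rV[R]_n) : atlas c ->
  (forall k (V : set 'rV[R]_n), Ck k V beta) ->
  compact K -> K `<=` chart_cod c -> (forall x, ~ K x -> beta x = 0) ->
  open B -> B `<=` chart_cod c -> (forall x, B x -> beta x = 1) ->
  forall x v i j, B x -> is_derive x v (fun x => chart_metric c x i j)
    (\sum_k v 0 k * (christoffel D c beta k x *m chart_metric c x +
                     chart_metric c x *m (christoffel D c beta k x)^T) i j).
Proof.
move=> ac sb cK sK bK oB sB bB x v i j Bx.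
pose line (s : R) : 'rV[R]_n := x + s *: v.
have [r0 r00 lineB] : exists2 r0 : R, 0 < r0 & forall s, - r0 < s < r0 -> B (line s).
  have cl : {for 0, continuous line} by by have := @Ck_line R n x v 0%N setT; apply.
  have nB : nbhs (line 0) B.
    by apply: open_nbhs_nbhs; split => //; rewrite /line scale0r addr0.
  have /nbhs_ballP [d /= d0 db] := cl _ nB; exists d => // s sd.
  by apply: db; rewrite -ball_normE /= sub0r normrN ltr_norml.
pose A s := - \sum_k v 0 k *: christoffel D c beta k (line s).
have oJ (r : R) : open (`]- r, r[%classic : set R) by exact: itv_open.
have sA i' j' : smooth_on `]- r0, r0[%classic (fun s => A s i' j').
  move=> N; apply: (@Ck_ext _ _ _ _ _
    (fun s => - \sum_k v 0 k * christoffel D c beta k (line s) i' j')) => //.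
    by move=> s _; rewrite [RHS]mxE summxE; congr (- _); apply: eq_bigr => k _; rewrite [RHS]mxE.
  apply: Ck_opp => //; apply: Ck_sum => // k; apply: Ck_mul => //; first exact: Ck_cst.
  have oc := chart_cod_open ac.
  have CG := christoffel_smooth covD ac sb cK sK bK k i' j' N.
  apply: (Ck_comp (oJ r0) oc _ CG); last exact: Ck_line.
  by move=> s; rewrite /= in_itv /= => sr; exact/sB/lineB.
have [h [U [W [h0 U0 W0 sU UW]]]] := linear_ode_inv r00 sA.
have lineBh s : `]- h, h[%classic s -> B (line s).
  by rewrite /= in_itv /= => sh; apply: lineB; lra.
have dU s : `]- h, h[%classic s -> forall i j, is_derive s (1 : R) (fun s => U s i j)
    ((U s *m - (\sum_k v 0 k *: christoffel D c beta k (line s))) i j).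
  by rewrite /= in_itv /= => sh; have [_ + _] := UW s sh; apply.
have hp : 0 < h by lra.
have [_ _ _ pres] := bmD.
have cline s : - h < s < h -> chart_cod c (line s).
  by move=> sh; apply/sB/lineBh; rewrite /= in_itv.
have metricU s : - h < s < h ->
    chart_metric c (line s) = W s *m chart_metric c x *m (W s)^T.
  move=> sh; have Js : `]- h, h[%classic s by rewrite /= in_itv.
  have [UWs _ _] := UW s sh.
  have h00 : - h < 0 < h by lra.
  have x0 : line 0 = x by rewrite /line scale0r addr0.
  have cx : chart_cod c x by exact: sB.
  have uU : U s \in unitmx by case: (mulmx1_unit UWs).
  have FU w : F (chart_inv c (line s)) (tangent_vec c (chart_inv c (line s)) (w *m U s)) =
      F (chart_inv c x) (tangent_vec c (chart_inv c x) w).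
    have := pres _ _ _ _ _
      (line_parallel_translation covD ac sb cK sK bK sB bB lineBh sU dU w hp Js).
    by rewrite U0 mulmx1 -/(line 0) x0.
  have G := loewner_transport ac (chart_inv_dom ac cx) (chart_inv_dom ac (cline _ sh)) uU FU.
  have UG : U s *m chart_metric c (line s) *m (U s)^T = chart_metric c x.
    apply/matrixP => i' j'.
    have := G (delta_mx 0 i') (delta_mx 0 j').
    rewrite !chart_metricE //; last exact: cline.
    have E (A' : 'M[R]_n) : ((delta_mx 0 i' : 'rV[R]_n) *m A' *m (delta_mx 0 j' : 'rV[R]_n)^T) 0 0 = A' i' j'.
      by rewrite trmx_delta -rowE -colE !mxE.
    rewrite E => <-; rewrite trmx_mul -E; congr (fun_of_matrix _ 0 0).
    by rewrite !mulmxA.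
  exact: congruence_inverse UWs UG.
have h00 : - h < 0 < h by lra.
have [_ _ dW] := UW 0 h00.
have dW' i' j' : is_derive (0 : R) (1 : R) (fun s => W s i' j') ((- A 0) i' j').
  by have := dW i' j'; rewrite W0 mulmx1 [X in _ -> is_derive _ _ _ X]mxE.
have dWG i' j' : is_derive (0 : R) (1 : R) (fun s => (W s *m chart_metric c x) i' j')
    ((- A 0 *m chart_metric c x) i' j').
  have dC k l : is_derive (0 : R) (1 : R) (fun _ : R => chart_metric c x k l) ((0 : 'M[R]_n) k l).
    by rewrite [X in is_derive _ _ _ X]mxE; exact: is_derive_cst.
  have := is_derive_mulmx dW' dC i' j'.
  by rewrite mulmx0 addr0.
have dWT i' j' : is_derive (0 : R) (1 : R) (fun s => (W s)^T i' j') ((- A 0)^T i' j').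
  have -> : (fun s => (W s)^T i' j') = fun s => W s j' i'.
    by apply/funext => s; rewrite mxE.
  by rewrite [(- A 0)^T i' j']mxE; exact: dW'.
have dT := is_derive_mulmx dWG dWT i j.
rewrite W0 trmx1 mulmx1 mul1mx in dT.
have dline : is_derive (0 : R) (1 : R) (fun s => chart_metric c (line s) i j)
    ((- A 0 *m chart_metric c x + chart_metric c x *m (- A 0)^T) i j).
  apply: near_eq_is_derive dT.
  have nJ : nbhs (0 : R) `]- h, h[%classic.
    by apply: open_nbhs_nbhs; split => //; rewrite /= in_itv.
  by apply: filterS nJ => s; rewrite /= in_itv /= => sh; rewrite metricU.
have x0 : x = x + (0 : R) *: v by rewrite scale0r addr0.
rewrite {1}x0; apply/(is_derive_line (fun x => chart_metric c x i j)).
suff -> : \sum_k v 0 k * (christoffel D c beta k x *m chart_metric c x +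
      chart_metric c x *m (christoffel D c beta k x)^T) i j =
    (- A 0 *m chart_metric c x + chart_metric c x *m (- A 0)^T) i j by [].
rewrite /A opprK -/(line 0) (_ : line 0 = x) ?/line ?scale0r ?addr0 //.
rewrite linear_sum mulmx_suml mulmx_sumr -big_split summxE /=.
apply: eq_bigr => k _.
by rewrite -scalemxAl linearZ /= -scalemxAr -scalerDr [RHS]mxE.
Qed.

End loewner_metric.

(** * Derivations along fields and tensoriality of metric compatibility *)

Section field_derivations.
Context {R : realType} {n : nat} (M : smooth_manifold R n).
Implicit Types (X Y Z : vector_field M) (f g : M -> R) (c : chart R n M).

Lemma smooth_fun_differentiable f c x : smooth_function f -> atlas c ->
  chart_cod c x -> differentiable (f \o chart_inv c) x.
Proof. by move=> sf ac cx; have [+ _] := sf c ac 1%N; apply. Qed.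

Let smooth_diff_at f p : smooth_function f ->
  differentiable (f \o chart_inv (chart_at p)) (chart_map (chart_at p) p).
Proof.
move=> sf; apply: smooth_fun_differentiable => //; first exact: chart_at_atlas.
exact/chart_map_cod/chart_at_dom.
Qed.

Lemma field_deriv_addl X X' f p :
  field_deriv (X \+ X') f p = field_deriv X f p + field_deriv X' f p.
Proof. by rewrite /field_deriv linearD. Qed.

Lemma field_deriv_scalel a X f p :
  field_deriv (fun q => a q *: X q) f p = a p * field_deriv X f p.
Proof. by rewrite /field_deriv linearZ. Qed.

Lemma field_deriv_add X f g p : smooth_function f -> smooth_function g ->
  field_deriv X (fun q => f q + g q) p = field_deriv X f p + field_deriv X g p.
Proof.
move=> sf sg; rewrite /field_deriv.
have H := diffD (smooth_diff_at p sf) (smooth_diff_at p sg).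
exact: (congr1 (fun l : 'rV[R]_n -> R => l (X p)) H).
Qed.

Lemma diff_mul_app (V : normedModType R) (f g : V -> R) (x v : V) :
  differentiable f x -> differentiable g x ->
  'd (fun y => f y * g y) x v = 'd f x v * g x + f x * 'd g x v.
Proof.
move=> df dg; have H := congr1 (fun l : V -> R => l v) (diffM df dg).
exact: etrans H (etrans (addrC _ _) (congr2 +%R (mulrC (g x) _) erefl)).
Qed.

Lemma field_deriv_mul X f g p : smooth_function f -> smooth_function g ->
  field_deriv X (fun q => f q * g q) p =
  field_deriv X f p * g p + f p * field_deriv X g p.
Proof.
move=> sf sg.
have := diff_mul_app (X p) (smooth_diff_at p sf) (smooth_diff_at p sg).
by rewrite /= chart_mapK //; [exact: chart_at_atlas|exact: chart_at_dom].
Qed.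

End field_derivations.

Section compatibility.
Context {R : realType} {n : nat} (M : smooth_manifold R n).
Variables (D : vector_field M -> vector_field M -> vector_field M)
  (g : M -> 'rV[R]_n -> 'rV[R]_n -> R).
Hypotheses (covD : covariant_derivative D) (spg : forall p, scalar_product (g p)).
Implicit Types (X Y Z : vector_field M) (f : M -> R) (c : chart R n M).

Lemma metric_addr p u v w : g p u (v + w) = g p u v + g p u w.
Proof. by have [lg _ _] := spg p; have := lg u 1 v w; rewrite scale1r mul1r. Qed.

Lemma metric_scaler p a u v : g p u (a *: v) = a * g p u v.
Proof.
have [lg _ _] := spg p.
have g0 : g p u 0 = 0.
  by have := lg u (-1) 0 0; rewrite scaler0 addr0 mulN1r addNr.
by have := lg u a v 0; rewrite !addr0 g0 addr0.
Qed.

Lemma metric_sym p u v : g p u v = g p v u.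
Proof. by have [_ + _] := spg p; apply. Qed.

Hypothesis sg : forall X Y, smooth_field X -> smooth_field Y ->
  smooth_function (fun q => g q (X q) (Y q)).

(* Tensorial in X, Y and Z: this reduces metric compatibility to a local frame. *)
Definition defect p X Y Z : R := field_deriv X (fun q => g q (Y q) (Z q)) p -
  (g p (D X Y p) (Z p) + g p (Y p) (D X Z p)).

Lemma defect_sym p X Y Z : defect p X Y Z = defect p X Z Y.
Proof.
have E : (fun q => g q (Y q) (Z q)) = fun q => g q (Z q) (Y q).
  by apply/funext => q; exact: metric_sym.
rewrite /defect E (metric_sym p (D X Y p)) (metric_sym p (Y p)).
by rewrite (addrC (g p (Z p) (D X Y p))).
Qed.

Lemma defect_addl p X X' Y Z : smooth_field X -> smooth_field X' ->
  smooth_field Y -> smooth_field Z ->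
  defect p (X \+ X') Y Z = defect p X Y Z + defect p X' Y Z.
Proof.
move=> sX sX' sY sZ; rewrite /defect field_deriv_addl !(cov_addl covD) //.
by rewrite metric_addr !(metric_sym p _ (Z p)) metric_addr; ring.
Qed.

Lemma defect_scalel p f X Y Z : smooth_function f -> smooth_field X ->
  smooth_field Y -> smooth_field Z ->
  defect p (fun q => f q *: X q) Y Z = f p * defect p X Y Z.
Proof.
move=> sf sX sY sZ; rewrite /defect field_deriv_scalel !(cov_scalel covD) //.
by rewrite metric_scaler !(metric_sym p _ (Z p)) metric_scaler; ring.
Qed.

Lemma defect_addr p X Y Z Z' : smooth_field X -> smooth_field Y ->
  smooth_field Z -> smooth_field Z' ->
  defect p X Y (Z \+ Z') = defect p X Y Z + defect p X Y Z'.
Proof.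
move=> sX sY sZ sZ'; rewrite /defect (cov_addr covD) //.
have -> : (fun q => g q (Y q) ((Z \+ Z') q)) = fun q => g q (Y q) (Z q) + g q (Y q) (Z' q).
  by apply/funext => q; exact: metric_addr.
rewrite field_deriv_add; [|exact: sg|exact: sg].
by rewrite !metric_addr [X in _ - X]addrACA opprD addrACA.
Qed.

Lemma defect_scaler p f X Y Z : smooth_function f -> smooth_field X ->
  smooth_field Y -> smooth_field Z ->
  defect p X Y (fun q => f q *: Z q) = f p * defect p X Y Z.
Proof.
move=> sf sX sY sZ; rewrite /defect (cov_scaler covD) //.
have -> : (fun q => g q (Y q) (f q *: Z q)) = fun q => f q * g q (Y q) (Z q).
  by apply/funext => q; exact: metric_scaler.
rewrite field_deriv_mul //; last exact: sg.
rewrite metric_addr !metric_scaler [X in _ - X]addrCA opprD addrACA subrr add0r.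
by rewrite -mulrDr -mulrBr.
Qed.

Lemma tensor_sum_eq0 p (t : vector_field M -> R) m (a : 'I_m -> M -> R)
    (E : 'I_m -> vector_field M) :
  (forall X Y, smooth_field X -> smooth_field Y -> t (X \+ Y) = t X + t Y) ->
  (forall f X, smooth_function f -> smooth_field X ->
     t (fun q => f q *: X q) = f p * t X) ->
  (forall i, smooth_function (a i)) -> (forall i, smooth_field (E i)) ->
  (forall i, t (E i) = 0) -> t (fun q => \sum_i a i q *: E i q) = 0.
Proof.
move=> tD tZ; elim: m a E => [|m IHm] a E sa sE tE.
  have -> : (fun q => \sum_(i < 0) a i q *: E i q) = (fun q => 0 *: (fun=> 0 : 'rV[R]_n) q).
    by apply/funext => q; rewrite big_ord0 scale0r.
  rewrite (tZ (fun=> 0) (fun=> 0)) ?mul0r //.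
    exact: smooth_fun_cst.
  exact: smooth_field0.
have -> : (fun q => \sum_(i < m.+1) a i q *: E i q) =
    (fun q => a ord0 q *: E ord0 q) \+
    (fun q => \sum_(i < m) a (lift ord0 i) q *: E (lift ord0 i) q).
  by apply/funext => q; rewrite big_ord_recl.
rewrite tD; [|exact: smooth_field_scale|exact: smooth_field_sum].
rewrite tZ // tE mulr0 add0r.
exact: (IHm (fun i => a (lift ord0 i)) (fun i => E (lift ord0 i))).
Qed.

Section local_frame.
Variables (c : chart R n M) (beta : 'rV[R]_n -> R) (K : set 'rV[R]_n) (p : M).
Hypotheses (ac : atlas c) (sbeta : forall k (V : set 'rV[R]_n), Ck k V beta)
  (compK : compact K) (subK : K `<=` chart_cod c)
  (betaK : forall x, ~ K x -> beta x = 0)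
  (cp : chart_dom c p) (betap : beta (chart_map c p) = 1).

(** With phi the cutoff function on M, phi(p) = 1 gives t(X) = t(phi^2 X), and phi^2 X is a
    combination of the extended frame with global smooth coefficients. *)
Lemma tensor_eq0 (t : vector_field M -> R) X :
  (forall X Y, smooth_field X -> smooth_field Y -> t (X \+ Y) = t X + t Y) ->
  (forall f X, smooth_function f -> smooth_field X ->
     t (fun q => f q *: X q) = f p * t X) ->
  (forall i : 'I_n, t (extend_field c beta (delta_mx 0 i)) = 0) ->
  smooth_field X -> t X = 0.
Proof.
move=> tD tZ tE sX.
pose phi := extend_fun c beta (fun=> 1).
have sphi : smooth_function phi.
  by apply: (extend_fun_smooth ac sbeta compK subK betaK) => k; exact: Ck_cst.
have phip : phi p = 1 by rewrite /phi /extend_fun mem_set // betap mulr1.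
have : t (fun q => (phi q * phi q) *: X q) = 0.
  have -> : (fun q => (phi q * phi q) *: X q) = fun q => \sum_i
      extend_fun c beta (fun x => tangent_coord c (chart_inv c x) (X (chart_inv c x)) 0 i) q
      *: extend_field c beta (delta_mx 0 i) q.
    by apply/funext => q; rewrite -expr2; exact: extend_decomposition.
  apply: (tensor_sum_eq0 (p := p)) => // i.
    exact: (extend_fun_coord_smooth ac sbeta compK subK betaK).
  exact: (extend_field_smooth ac sbeta compK subK betaK).
by rewrite (tZ (fun q => phi q * phi q)) ?phip ?mulr1 ?mul1r //; exact: smooth_fun_mul.
Qed.

Lemma defect_eq0 X Y Z :
  (forall i j k : 'I_n, defect p (extend_field c beta (delta_mx 0 k))
     (extend_field c beta (delta_mx 0 i)) (extend_field c beta (delta_mx 0 j)) = 0) ->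
  smooth_field X -> smooth_field Y -> smooth_field Z -> defect p X Y Z = 0.
Proof.
move=> dE sX sY sZ.
have sE y := extend_field_smooth ac sbeta compK subK betaK y.
(* The reduction to the frame acts on Z, then on X, and finally on Y once the symmetry of the defect
   has moved it to the last place. *)
apply: (tensor_eq0 (t := defect p X Y)) => //.
- by move=> Z1 Z2 s1 s2; exact: defect_addr.
- by move=> f Z1 sf s1; exact: defect_scaler.
move=> j; apply: (tensor_eq0 (t := fun X => defect p X Y (extend_field c beta (delta_mx 0 j)))) => //.
- by move=> X1 X2 s1 s2; exact: defect_addl.
- by move=> f X1 sf s1; exact: defect_scalel.
move=> k; rewrite defect_sym.
apply: (tensor_eq0 (t := defect p (extend_field c beta (delta_mx 0 k))
  (extend_field c beta (delta_mx 0 j)))) => //.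
- by move=> Z1 Z2 s1 s2; exact: defect_addr.
- by move=> f Z1 sf s1; exact: defect_scaler.
Qed.

End local_frame.

End compatibility.

(** * Smoothness of the Loewner metric and its compatibility with D *)

Section assembly.
Context {R : realType} {n : nat} (M : smooth_manifold R n).
Variables (F : M -> 'rV[R]_n -> R)
  (D : vector_field M -> vector_field M -> vector_field M)
  (gL : forall p : M, 'rV[R]_n -> 'rV[R]_n -> R).
Hypotheses (bmD : berwald_matveev F D)
  (gLP : forall p, scalar_product (gL p) /\
     loewner_ellipsoid (gauge_ball (F p)) (ellipsoid (gL p))).
Implicit Types (X Y Z : vector_field M) (c d : chart R n M).

Let covD : covariant_derivative D. Proof. by case: bmD. Qed.

Lemma chart_cutoff c (x0 : 'rV[R]_n) : atlas c -> chart_cod c x0 ->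
  exists beta : 'rV[R]_n -> R, exists K : set 'rV[R]_n, exists r : R,
    [/\ forall k (V : set 'rV[R]_n), Ck k V beta,
        compact K /\ K `<=` chart_cod c,
        forall x, ~ K x -> beta x = 0,
        0 < r /\ ball x0 r `<=` chart_cod c &
        forall x, ball x0 r x -> beta x = 1].
Proof.
move=> ac cx0.
have nc : nbhs x0 (chart_cod c) by apply: open_nbhs_nbhs; split => //; exact: chart_cod_open.
have [beta [K [sb b1 cK sK bK]]] := smooth_cutoff nc.
have nn : nbhs x0 [set x | chart_cod c x /\ beta x = 1] by apply: filterI.
move: nn => /nbhs_ballP [r /= r0 rb].
by exists beta, K, r; split => //; [split => // x /rb[]|move=> x /rb[]].
Qed.

(** Smoothness is local, so each point gets its own cutoff, and the total differential system is
    used on the ball where this cutoff is 1. *)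
Lemma chart_metric_smooth c i j : atlas c ->
  smooth_on (chart_cod c) (fun x => chart_metric gL c x i j).
Proof.
move=> ac N; apply: Ck_local => x0 cx0.
have [beta [K [r [sb [cK sK] bK [r0 rc] b1]]]] := chart_cutoff ac cx0.
have oB : open (ball x0 r) by exact: ball_open.
have Bx0 : ball x0 r x0 by exact: ballxx.
have dG := chart_metric_derive bmD gLP ac sb cK sK bK oB rc b1.
have sGam k i' j' : smooth_on (ball x0 r) (fun x => christoffel D c beta k x i' j').
  by move=> N'; apply: Ck_sub rc (christoffel_smooth covD ac sb cK sK bK k i' j' N').
have [r' r'0 sG] := total_differential_smooth oB Bx0 sGam dG.
exists (ball x0 r'); split; [exact: ball_open|exact: ballxx|exact: sG].
Qed.

Lemma loewner_inner_smooth X Y : smooth_field X -> smooth_field Y ->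
  smooth_function (fun q => gL q (X q) (Y q)).
Proof.
move=> sX sY c ac N; have oc := chart_cod_open ac.
have CX i := Ck_coord i oc (sX c ac N).
have CY i := Ck_coord i oc (sY c ac N).
have CG i j := @chart_metric_smooth c i j ac N.
have := Ck_sum oc (fun j => Ck_mul oc (Ck_sum oc (fun i => Ck_mul oc (CX i) (CG i j))) (CY j)).
apply: Ck_ext => // x cx /=.
have cp := chart_inv_dom ac cx.
rewrite -[in RHS](tangent_coordK ac cp (X _)) -[in RHS](tangent_coordK ac cp (Y _)).
rewrite (chart_metricE gLP) // [RHS]mxE; apply: eq_bigr => j _.
by rewrite [in RHS]mxE; congr (_ * _); rewrite [RHS]mxE.
Qed.

Lemma loewner_riemannian : riemannian_metric gL.
Proof.
split=> [p|c ac y z N]; first by case: (gLP p).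
have oc := chart_cod_open ac.
have CG i j := @chart_metric_smooth c i j ac N.
have := Ck_sum oc (fun j => Ck_mul oc (Ck_sum oc (fun i =>
  Ck_mul oc (Ck_cst N _ (y 0 i)) (CG i j))) (Ck_cst N _ (z 0 j))).
apply: Ck_ext => // x cx.
rewrite (chart_metricE gLP) // [RHS]mxE; apply: eq_bigr => j _.
by rewrite [in RHS]mxE; congr (_ * _); rewrite [RHS]mxE.
Qed.

(** By tensoriality it is enough to treat an extended coordinate frame at p. There the system in
    direction e_k reads d_k G_ij = (Gamma_k G)_ij + (G Gamma_k^T)_ij, and the two terms are the
    inner products of D_k E_i with E_j and of E_i with D_k E_j. *)
Lemma loewner_metric_derivative : metric_derivative gL D.
Proof.
move=> X Y Z sX sY sZ p; apply/eqP; rewrite -subr_eq0; apply/eqP.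
set c := chart_at p; have ac : atlas c by exact: chart_at_atlas.
have cp : chart_dom c p by exact: chart_at_dom.
have cx0 := chart_map_cod cp.
have [beta [K [r [sb [cK sK] bK [r0 rc] b1]]]] := chart_cutoff ac cx0.
set x0 := chart_map c p in cx0 r0 rc b1.
have oB : open (ball x0 r) by exact: ball_open.
have Bx0 : ball x0 r x0 by exact: ballxx.
have spL q : scalar_product (gL q) by case: (gLP q).
apply: (defect_eq0 covD spL loewner_inner_smooth ac sb cK sK bK cp (b1 _ Bx0)) => //.
move=> i j k; have px0 : p = chart_inv c x0 by rewrite chart_mapK.
have sE y := extend_field_smooth ac sb cK sK bK y.
have sI := loewner_inner_smooth (sE (delta_mx 0 i)) (sE (delta_mx 0 j)).
have dI := smooth_fun_differentiable sI ac cx0.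
have Q1 : \sum_l (delta_mx 0 k : 'rV[R]_n) 0 l *: christoffel D c beta l x0 =
    christoffel D c beta k x0.
  rewrite (bigD1 k) //= big1 => [|l lk]; last first.
    by rewrite [X in X *: _]mxE eqxx (negbTE lk) scale0r.
  by rewrite [X in X *: _]mxE !eqxx scale1r addr0.
have tcp y : extend_field c beta y p = tangent_vec c p y.
  have := extend_field_B ac rc b1 y Bx0; by rewrite -px0.
have covE l : D (extend_field c beta (delta_mx 0 k)) (extend_field c beta (delta_mx 0 l)) p =
    tangent_vec c p (row l (christoffel D c beta k x0)).
  have := cov_extend covD ac sb cK sK bK (delta_mx 0 k) l x0.
  by rewrite -px0 Q1 => <-; rewrite tangent_coordK.
have metE y z : gL p (tangent_vec c p y) (tangent_vec c p z) =
    (y *m chart_metric gL c x0 *m z^T) 0 0.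
  have := chart_metricE gLP y z ac cx0; by rewrite -px0.
have := chart_metric_derive bmD gLP ac sb cK sK bK oB rc b1 (delta_mx 0 k) i j Bx0.
move: Q1 covE metE; set Gam := christoffel D c beta k x0.
set Gm := chart_metric gL c x0 => Q1 covE metE [_ dG].
rewrite /defect (field_derivE ac cp _ dI) !covE !tcp !metE (tangent_vecK ac cp) -deriveE //.
apply/eqP; rewrite subr_eq0; apply/eqP; apply: etrans (etrans dG _).
  (* On the whole ball the inner product of the frame fields is the entry G_ij, so both have the
     same derivative at its centre. *)
  apply: near_eq_derive.
  have nB : nbhs x0 (ball x0 r) by exact: open_nbhs_nbhs.
  apply: filterS nB => x bx /=; have cx := rc _ bx.
  rewrite !(extend_field_B ac rc b1 _ bx) (chart_metricE gLP _ _ ac cx).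
  by rewrite trmx_delta -rowE -colE [LHS]mxE [LHS]mxE.
rewrite (bigD1 k) //= big1 => [|l lk]; last first.
  by rewrite [X in X * _]mxE eqxx (negbTE lk) mul0r.
rewrite [X in X * _]mxE !eqxx mul1r addr0 [LHS]mxE; congr (_ + _).
  by rewrite trmx_delta -row_mul -colE [RHS]mxE [RHS]mxE.
by rewrite tr_row -rowE -row_mul colE mulmxA -colE [RHS]mxE [RHS]mxE.
Qed.

End assembly.

Theorem mainTheorem4 (R : realType) (n : nat) (M : smooth_manifold R n)
    (F : M -> 'rV[R]_n -> R)
    (D : vector_field M -> vector_field M -> vector_field M)
    (gL : forall p : M, 'rV[R]_n -> 'rV[R]_n -> R) :
  berwald_matveev F D ->
  (forall p : M, scalar_product (gL p) /\
                 loewner_ellipsoid (gauge_ball (F p)) (ellipsoid (gL p))) ->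
  riemannian_metric gL /\ levi_civita gL D.
Proof.
move=> bmD gLP; split; first exact: (loewner_riemannian bmD gLP).
have [_ cD tD _] := bmD; split => //.
exact: (loewner_metric_derivative bmD gLP).
Qed.
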